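(* Let $f=x_1x_5+x_2^2+x_3^2+x_4^2$. In the affine space $\mathbb{A}^{10}\subset{\rm VSP}(f)$ the algebraic boundary $\partial_{alg}{\rm SSP}(f)$ is an irreducible hypersurface of degree $10$.
   Context: Let $V^*$ be the space of linear forms in $x_1,\dots,x_5$, so $f\in S^2(V^* )$, and let $\mathbb{P}(V^* )\cong\mathbb{P}^4$ be the projective space of lines in $V^*$, with homogeneous coordinates $y_1,\dots,y_5\in V$ ($y_i$ dual to $x_i$, acting on forms as $\partial/\partial x_i$). The (complex Waring) rank of $f$ is $r=5$. The variety of sums of powers is ${\rm VSP}(f)=\overline{\{\{[\ell_1],\dots,[\ell_r]\} : f=\sum_{i=1}^r\lambda_i\ell_i^2,\ \lambda_i\in\mathbb{C},\ [\ell_i]\in\mathbb{P}(V^* )\}}$, where the closure is taken in the (smoothable component of the) Hilbert scheme of $r$ points in $\mathbb{P}(V^* )$. For this $f$ it is a smooth ten-dimensional variety whose points correspond to length-$5$ subschemes of $\mathbb{P}(V^* )$ apolar to $f$ (homogeneous ideal contained in the ideal $f^\perp$ of differential operators annihilating $f$). The space of sums of powers ${\rm SSP}(f)$ is the semialgebraic subset of the real locus of ${\rm VSP}(f)$ consisting of those decompositions $f=\sum\lambda_i\ell_i^2$ in which all $\ell_i$ are real. Its algebraic boundary $\partial_{alg}{\rm SSP}(f)$ is the Zariski closure in ${\rm VSP}(f)$ of the difference of the Euclidean closure of ${\rm SSP}(f)$ minus the interior of that closure (interior taken in the real locus). The affine patch $\mathbb{A}^{10}\subset{\rm VSP}(f)$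 (Ranestad–Schreyer) is the open set of those apolar schemes $\Gamma$ that are disjoint from the hyperplane $\{y_1=0\}$. For such $\Gamma$ and $2\le i\le j\le 4$ the ideal of $\Gamma$ contains a unique quadric of the form $$y_iy_j-2\delta_{ij}\,y_1y_5-\sum_{k=2}^4a_{ijk}\,y_1y_k-c_{ij}\,y_1^2,$$ the coefficients $a_{ijk}$ are symmetric in $i,j,k\in\{2,3,4\}$, and the ten resulting functions $a_{ijk}$ ($2\le i\le j\le k\le4$) are coordinates identifying this open set with $\mathbb{A}^{10}$. ''Degree'' refers to these coordinates. *)

(* Defs.v *)
From mathcomp Require Import all_boot all_order all_algebra.
(* The notations of mpoly are incompatible with those of mathcomp-analysis. *)
From mathcomp Require Export -(notations) mpoly.
From mathcomp Require Export complex.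
From mathcomp Require Export all_classical all_reals topology normedtype.
Export numFieldNormedType.Exports.

Set Implicit Arguments.
Unset Strict Implicit.
Unset Printing Implicit Defensive.

Import Order.TTheory GRing.Theory Num.Theory.
Local Open Scope ring_scope.
Local Open Scope classical_set_scope.

(* The same type serves for forms in x_1, ..., x_5 and for the differential
   operators in y_1, ..., y_5 acting on them. *)
Definition poly5 (R : realType) := mpoly 5 R[i].

(* Numbered from 1: var R k is x_k, or y_k, for 1 <= k <= 5. *)
Definition var (R : realType) (k : nat) : poly5 R :=
  mpolyX R[i] (mnm1 (inord k.-1 : 'I_5)).

Definition quadric (R : realType) : poly5 R :=
  var R 1 * var R 5 + var R 2 ^+ 2 + var R 3 ^+ 2 + var R 4 ^+ 2.

Definition linear_form (R : realType) (v : 'rV[R[i]]_5) : poly5 R :=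
  \sum_(j < 5) v 0 j *: mpolyX R[i] (mnm1 j).

Definition complexify (R : realType) (n : nat) (v : 'rV[R]_n) : 'rV[R[i]]_n :=
  map_mx (fun x : R => (x%:C)%C) v.

(* The operator g with y_i acting as d/dx_i. *)
Definition diff_act (R : realType) (g h : poly5 R) : poly5 R :=
  \sum_(m <- msupp g) mcoeff m g *: mderivm m h.

Definition annihilator (R : realType) (f : poly5 R) : set (poly5 R) :=
  [set g | diff_act g f = 0].

Definition homogeneous_ideal (R : realType) (I : set (poly5 R)) : Prop :=
  [/\ I 0,
      forall g h, I g -> I h -> I (g + h),
      forall g h, I h -> I (g * h)
    & forall g d, I g -> I (pihomog mdeg d g)].

Definition saturated (R : realType) (I : set (poly5 R)) : Prop :=
  forall (g : poly5 R) (k : nat),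
    (forall h : poly5 R, h \is ishomog1 k mdeg -> I (h * g)) -> I g.

(* The degree d part of the quotient by I has dimension r: the b i form a basis
   of the forms of degree d modulo I. *)
Definition quotient_dim (R : realType) (I : set (poly5 R)) (d r : nat) : Prop :=
  exists b : 'I_r -> poly5 R,
    (forall i, b i \is ishomog1 d mdeg) /\
    forall g : poly5 R, g \is ishomog1 d mdeg ->
      exists! c : 'rV[R[i]]_r, I (g - \sum_(i < r) c 0 i *: b i).

(* Closed subschemes of P(V^* ) are represented by their saturated homogeneous
   ideals; the length of a finite one is its constant Hilbert polynomial. *)
Definition finite_subscheme (R : realType) (r : nat) (I : set (poly5 R)) : Prop :=
  [/\ homogeneous_ideal I,
      saturated I
    & exists d0, forall d, (d0 <= d)%N -> quotient_dim I d r].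

(* The points of VSP(f), for f the nondegenerate quadric above, are the apolar
   subschemes of length 5. *)
Definition VSP (R : realType) (f : poly5 R) : set (set (poly5 R)) :=
  [set I | finite_subscheme 5 I /\ I `<=` annihilator f].

(* A polynomial is in the homogeneous ideal of the points [p i] iff it vanishes
   on the lines they span. *)
Definition ideal_of_points (R : realType) (r : nat) (p : 'I_r -> 'rV[R[i]]_5) :
    set (poly5 R) :=
  [set g | forall (i : 'I_r) (t : R[i]), meval (fun j => t * p i 0 j) g = 0].

Definition SSP (R : realType) (f : poly5 R) : set (set (poly5 R)) :=
  [set I | VSP f I /\
    exists (l : 'I_5 -> 'rV[R]_5) (lambda : 'I_5 -> R[i]),
      [/\ forall i, l i != 0,
          f = \sum_(i < 5) lambda i *: linear_form (complexify (l i)) ^+ 2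
        & I = ideal_of_points (fun i => complexify (l i))]].

Definition disjoint_from_y1 (R : realType) (I : set (poly5 R)) : Prop :=
  forall p : 'rV[R[i]]_5, p != 0 ->
    (forall g, I g -> meval (p 0) g = 0) -> meval (p 0) (var R 1) != 0.

Definition affine_patch (R : realType) (f : poly5 R) : set (set (poly5 R)) :=
  [set I | VSP f I /\ disjoint_from_y1 I].

Definition triples : seq (seq nat) :=
  [:: [:: 2; 2; 2]; [:: 2; 2; 3]; [:: 2; 2; 4]; [:: 2; 3; 3]; [:: 2; 3; 4];
      [:: 2; 4; 4]; [:: 3; 3; 3]; [:: 3; 3; 4]; [:: 3; 4; 4]; [:: 4; 4; 4]]%N.

(* The position in A^10 of the coordinate a_ijk, symmetric in i, j, k. *)
Definition coord_index (i j k : nat) : 'I_10 :=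
  inord (index (sort leq [:: i; j; k]) triples).

(* a is the vector of the ten coordinates a_ijk of the subscheme defined by I. *)
Definition has_coordinates (R : realType) (I : set (poly5 R))
    (a : 'rV[R[i]]_10) : Prop :=
  forall i j : nat, (2 <= i)%N -> (i <= j)%N -> (j <= 4)%N ->
    exists c : R[i],
      I (var R i * var R j
         - (if i == j then 2%:R else 0) *: (var R 1 * var R 5)
         - \sum_(2 <= k < 5) a 0 (coord_index i j k) *: (var R 1 * var R k)
         - c *: var R 1 ^+ 2).

(* The trace of SSP(f) on the real locus R^10 of the affine patch A^10. *)
Definition SSP_patch (R : realType) (f : poly5 R) : set 'rV[R]_10 :=
  [set a | exists I, [/\ SSP f I, affine_patch f I
                       & has_coordinates I (complexify a)]].

Definition zero_locus (R : realType) (n : nat) (F : mpoly n R[i]) :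
    set 'rV[R[i]]_n :=
  [set a | meval (a 0) F = 0].

Definition zariski_closure (R : realType) (n : nat) (A : set 'rV[R[i]]_n) :
    set 'rV[R[i]]_n :=
  [set a | forall F : mpoly n R[i], A `<=` zero_locus F -> zero_locus F a].

(* Since A^10 is Zariski open in VSP(f) and R^10 is open in its real locus,
   closures and interiors may be taken inside the patch. *)
Definition alg_boundary_SSP (R : realType) (f : poly5 R) : set 'rV[R[i]]_10 :=
  zariski_closure
    (@complexify R 10 @` (closure (SSP_patch f) `\` (closure (SSP_patch f))°)).

Definition irreducible_mpoly (R : realType) (n : nat) (F : mpoly n R[i]) : Prop :=
  [/\ F != 0, F \isn't a GRing.unit
    & forall G H : mpoly n R[i], F = G * H ->
        G \is a GRing.unit \/ H \is a GRing.unit].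

(* mmeasure mdeg F is msize F, that is, the total degree of F plus one. *)
Definition irreducible_hypersurface (R : realType) (n d : nat)
    (Z : set 'rV[R[i]]_n) : Prop :=
  exists F : mpoly n R[i],
    [/\ irreducible_mpoly F, mmeasure mdeg F = d.+1 & Z = zero_locus F].

(* Main.v *)
Require Import Defs.
From mathcomp Require Import all_boot all_order all_algebra.
From mathcomp Require Import all_classical all_reals.
From mathcomp Require Import topology normedtype polyXY perm.
From mathcomp Require Import ring lra.

(* In the basis 1, y_2, y_3, y_4, y_5 the coordinate ring of the apolar scheme
   with coordinates a has structure constants polynomial in a. The scheme
   consists of five real points with real coefficients exactly when the trace
   form of this algebra is positive definite: the multiplication matrices commute
   and are self-adjoint for the trace form, so they are simultaneously
   diagonalizable. Hence the boundary lies in the zero locus of the discriminant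
   F, the determinant of the trace form, which is homogeneous of degree 10.
   Conversely let G vanish on the boundary, and let v be the direction of the
   coordinate a_234. All real lines in the direction v near a suitable point
   cross the boundary, so the resultant of F(a + Z v) and G(a + Z v) with respect
   to Z vanishes on a real ball, hence identically. Since F(a + Z v) has constant
   leading coefficient and is irreducible over C(a), it divides G(a + Z v).
   Irreducibility is checked on a one-parameter family of lines, where F becomes
   an explicit polynomial in two variables to which Eisenstein's criterion applies
   after a substitution. *)

Set Implicit Arguments.
Unset Strict Implicit.
Unset Printing Implicit Defensive.

Import Order.TTheory GRing.Theory Num.Theory.
Import numFieldNormedType.Exports.
Local Open Scope ring_scope.

(** * The structure constants and the trace form *)

(** Multiplication in the coordinate ring is self-adjoint for the bilinear form of f as well as for
    the trace form. Given A, the first fact leaves only c, d, e open in the multiplication table,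
    and associativity makes these polynomials in A; the scaling A = a / 4 gives them integer
    coefficients. The determinant F, of degree 10 in ten variables, is never expanded: its degree
    comes from a grading, the rest from two sparse families of tensors. The direction a_234 serves
    twice. F does not vanish on it, so F(a + Z v) has a constant leading coefficient. On the plane
    of a_222 and a_234, F is a constant times s^4 (s^2 - x^2)^3, and the odd exponent makes F change
    sign at the edge of the positive definite region; this is what forces all nearby parallel lines
    to cross the boundary. Irreducibility over C(a) is expressed with a denominator: if c F = D Q
    with c nonzero, then D or Q is constant in Z. A special line may lie in the zero set of c, so
    denominators have to be removed before specialising. *)

Section StructureConstants.
Context (K : comNzRingType).

(* The structure constants of a five-dimensional algebra with basis
   1, y_2, y_3, y_4, y_5, numbered from 0: the coefficient of the j-th basis
   element in the product of the k-th and the i-th one. *)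
Definition sc_gen (A : nat -> nat -> nat -> K) (c : nat -> nat -> K)
    (d : nat -> K) (e : K) (k i j : nat) : K :=
  match k, i with
  | 0%N, _ => (i == j)%:R
  | _, 0%N => (k == j)%:R
  | 4%N, 4%N => match j with 0%N => e | 4%N => 0 | _ => d j end
  | 4%N, m | m, 4%N => match j with 0%N => d m *+ 2 | 4%N => 0 | _ => c m j end
  | _, _ => match j with 0%N => c k i *+ 2 | 4%N => (k == i)%:R *+ 2 | _ => A k i j *+ 4 end
  end.

Context (A : nat -> nat -> nat -> K).

(* sc_c, sc_d and sc_e are the values forced by associativity, for A = a / 4. *)
Definition sc_N (k m : nat) : K :=
  \sum_(1 <= j < 4) \sum_(1 <= l < 4) (A k j l * A l j m - A j l l * A j k m).

(** Contracting two indices in the linear part of y_k (y_i y_j) = y_i (y_k y_j) gives c + tr(c) I =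
    8 N, hence tr(c) = 2 tr(N). The same contraction of the constant terms gives [sc_d], and the
    constant term of y_2 (y_2 y_5) = (y_2 y_2) y_5 gives [sc_e]. *)
Definition sc_c (k m : nat) : K :=
  sc_N k m *+ 8 - (k == m)%:R * (\sum_(1 <= j < 4) sc_N j j) *+ 2.

Definition sc_d (k : nat) : K :=
  \sum_(1 <= j < 4) \sum_(1 <= l < 4) (A k j l * sc_c j l - A j l l * sc_c j k).

Definition sc_e : K :=
  \sum_(1 <= l < 4) (sc_c 1 l * sc_c 1 l - A 1 1 l * sc_d l *+ 4).

Definition sc (k i j : nat) : K := sc_gen A sc_c sc_d sc_e k i j.

Definition sc_tr (k : nat) : K := \sum_(0 <= i < 5) sc k i i.

Definition trace_entry (j k : nat) : K := \sum_(0 <= l < 5) sc j k l * sc_tr l.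

Definition trace_form : 'M[K]_5 := \matrix_(j, k) trace_entry j k.

Definition disc : K := \det trace_form.
End StructureConstants.

Section Morphism.
Context (K L : comNzRingType) (f : {rmorphism K -> L}).
Context (A : nat -> nat -> nat -> K).
Let fA i j k := f (A i j k).

Lemma sc_morph k i j : f (sc A k i j) = sc fA k i j.
Proof.
have fN k' m' : f (sc_N A k' m') = sc_N fA k' m'.
  rewrite rmorph_sum; apply: eq_bigr => j' _; rewrite rmorph_sum.
  by apply: eq_bigr => l _; rewrite rmorphB !rmorphM.
have fc k' m' : f (sc_c A k' m') = sc_c fA k' m'.
  rewrite /sc_c rmorphB !rmorphMn rmorphM fN rmorph_nat rmorph_sum.
  by congr (_ - _ * _ *+ _); apply: eq_bigr => j' _.
have fd k' : f (sc_d A k') = sc_d fA k'.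
  rewrite /sc_d rmorph_sum; apply: eq_bigr => j' _; rewrite rmorph_sum.
  by apply: eq_bigr => l _; rewrite rmorphB !rmorphM !fc.
have fe : f (sc_e A) = sc_e fA.
  rewrite /sc_e rmorph_sum; apply: eq_bigr => l _.
  by rewrite rmorphB rmorphMn !rmorphM fc fd.
rewrite /sc /sc_gen.
by case: k => [|[|[|[|[|k]]]]]; case: i => [|[|[|[|[|i]]]]];
   case: j => [|[|[|[|[|j]]]]];
   rewrite ?rmorphMn ?fc ?fd ?fe ?rmorph1 ?rmorph0.
Qed.

Lemma sc_tr_morph k : f (sc_tr A k) = sc_tr fA k.
Proof. by rewrite rmorph_sum; apply: eq_bigr => i _; rewrite sc_morph. Qed.

Lemma trace_entry_morph j k : f (trace_entry A j k) = trace_entry fA j k.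
Proof.
by rewrite rmorph_sum; apply: eq_bigr => l _; rewrite rmorphM sc_tr_morph sc_morph.
Qed.

Lemma disc_morph : f (disc A) = disc fA.
Proof.
rewrite /disc -det_map_mx; congr (\det _).
by apply/matrixP => i j; rewrite !mxE trace_entry_morph.
Qed.
End Morphism.

Lemma sum_1_4 (K : nmodType) (F : nat -> K) :
  \sum_(1 <= j < 4) F j = F 1%N + (F 2%N + F 3%N).
Proof. by rewrite unlock /= addr0. Qed.

Lemma sum_0_5 (K : nmodType) (F : nat -> K) :
  \sum_(0 <= j < 5) F j = F 0%N + (F 1%N + (F 2%N + (F 3%N + F 4%N))).
Proof. by rewrite unlock /= addr0. Qed.

Definition symmetric3 (K : Type) (A : nat -> nat -> nat -> K) :=
  forall i j k, A i j k = A j i k /\ A i j k = A i k j.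

(** A multirule that sorts the indices; otherwise [ring] would take equal entries for distinct
    atoms. *)
Lemma symmetric3_sort (K : Type) (A : nat -> nat -> nat -> K) : symmetric3 A ->
 (((A 1 2 1 = A 1 1 2) * (A 2 1 1 = A 1 1 2) * (A 1 3 1 = A 1 1 3) * (A 3 1 1 = A 1 1 3) *
   (A 2 1 2 = A 1 2 2) * (A 2 2 1 = A 1 2 2) * (A 3 1 3 = A 1 3 3) * (A 3 3 1 = A 1 3 3)) *
  ((A 1 3 2 = A 1 2 3) * (A 2 1 3 = A 1 2 3) * (A 2 3 1 = A 1 2 3) * (A 3 1 2 = A 1 2 3) *
   (A 3 2 1 = A 1 2 3)) *
  ((A 2 3 2 = A 2 2 3) * (A 3 2 2 = A 2 2 3) * (A 3 2 3 = A 2 3 3) * (A 3 3 2 = A 2 3 3)))%type.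
Proof.
move=> sA; have s1 i j k := (sA i j k).1; have s2 i j k := (sA i j k).2.
do !split; first [exact: s1 | exact: s2 | by rewrite s2 s1 | by rewrite s1 s2 | by rewrite s1 s2 s1].
Qed.

Section Associativity.
Context (K : comNzRingType) (A : nat -> nat -> nat -> K).
Hypothesis symA : symmetric3 A.
Let sA := symmetric3_sort symA.

Lemma sc_cC : ((sc_c A 2 1 = sc_c A 1 2) * (sc_c A 3 1 = sc_c A 1 3) *
  (sc_c A 3 2 = sc_c A 2 3))%type.
Proof. by do !split; rewrite /sc_c /sc_N !sum_1_4 /= !sA; ring. Qed.

Lemma sc_cE : (
   (sc_c A 1 1 = (- A 1 1 1 * A 1 2 2 - A 1 1 1 * A 1 3 3 + A 1 1 2 *
      A 1 1 2 - A 1 1 2 * A 2 2 2 - A 1 1 2 * A 2 3 3 + A 1 1 3 * A 1 1 3 -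
      A 1 1 3 * A 2 2 3 - A 1 1 3 * A 3 3 3 + A 1 2 2 * A 1 2 2 + A 1 2 2 *
      A 1 3 3 + A 1 2 3 * A 1 2 3 + A 1 3 3 * A 1 3 3 + A 2 2 2 * A 2 3 3 -
      A 2 2 3 * A 2 2 3 + A 2 2 3 * A 3 3 3 - A 2 3 3 * A 2 3 3) *+ 4) *
   (sc_c A 1 2 = (- A 1 1 2 * A 1 3 3 + A 1 1 3 * A 1 2 3 - A 1 2 2 *
      A 2 3 3 + A 1 2 3 * A 2 2 3 - A 1 2 3 * A 3 3 3 + A 1 3 3 * A 2 3 3)
      *+ 8) *
   (sc_c A 1 3 = (A 1 1 2 * A 1 2 3 - A 1 1 3 * A 1 2 2 + A 1 2 2 * A 2 2 3
      - A 1 2 3 * A 2 2 2 + A 1 2 3 * A 2 3 3 - A 1 3 3 * A 2 2 3) *+ 8) *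
   (sc_c A 2 2 = (- A 1 1 1 * A 1 2 2 + A 1 1 1 * A 1 3 3 + A 1 1 2 *
      A 1 1 2 - A 1 1 2 * A 2 2 2 + A 1 1 2 * A 2 3 3 - A 1 1 3 * A 1 1 3 -
      A 1 1 3 * A 2 2 3 + A 1 1 3 * A 3 3 3 + A 1 2 2 * A 1 2 2 - A 1 2 2 *
      A 1 3 3 + A 1 2 3 * A 1 2 3 - A 1 3 3 * A 1 3 3 - A 2 2 2 * A 2 3 3 +
      A 2 2 3 * A 2 2 3 - A 2 2 3 * A 3 3 3 + A 2 3 3 * A 2 3 3) *+ 4) *
   (sc_c A 2 3 = (- A 1 1 1 * A 1 2 3 + A 1 1 2 * A 1 1 3 - A 1 1 2 *
      A 2 2 3 - A 1 1 3 * A 2 3 3 + A 1 2 2 * A 1 2 3 + A 1 2 3 * A 1 3 3)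
      *+ 8) *
   (sc_c A 3 3 = (A 1 1 1 * A 1 2 2 - A 1 1 1 * A 1 3 3 - A 1 1 2 * A 1 1 2
      + A 1 1 2 * A 2 2 2 - A 1 1 2 * A 2 3 3 + A 1 1 3 * A 1 1 3 + A 1 1 3
      * A 2 2 3 - A 1 1 3 * A 3 3 3 - A 1 2 2 * A 1 2 2 - A 1 2 2 * A 1 3 3
      + A 1 2 3 * A 1 2 3 + A 1 3 3 * A 1 3 3 - A 2 2 2 * A 2 3 3 + A 2 2 3
      * A 2 2 3 - A 2 2 3 * A 3 3 3 + A 2 3 3 * A 2 3 3) *+ 4))%type.
Proof. by do !split; rewrite /sc_c /sc_N !sum_1_4 /= !sA; ring. Qed.

Lemma sc_assoc k l i j : (0 < k < 4)%N -> (0 < l < 4)%N -> (i < 5)%N -> (j < 5)%N ->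
  \sum_(0 <= m < 5) sc A k i m * sc A l m j = \sum_(0 <= m < 5) sc A l i m * sc A k m j.
Proof.
rewrite !sum_0_5.
(* Exchanging k and l exchanges the two sides, so only three pairs remain for the case analysis. *)
wlog: k l / (k < l)%N.
  by move=> hw k4 l4 i5 j5; case: (ltngtP k l) => [/hw|/hw H|->//]; [exact|rewrite H].
case: k => [//|[|[|[|//]]]] + _; case: l => [//|[|[|[|//]]]] // _ _.
all: case: i => [|[|[|[|[|//]]]]] _; case: j => [|[|[|[|[|//]]]]] _.
all: rewrite /sc /sc_gen /= /sc_d ?sum_1_4.
all: rewrite ?(mul0r, mul1r, mulr0, mulr1, mulr0n, mulr1n, add0r, addr0, mul0rn, subr0).
all: rewrite ?sc_cC.
all: rewrite ?sA.
all: rewrite ?sc_cE.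
all: ring.
Qed.

(** This writes multiplication by y_5 as a polynomial in the multiplications by y_2, y_3, y_4, so
    that it commutes with them without any further identity of high degree. *)
Lemma sc_sqr i j : (i < 5)%N -> (j < 5)%N ->
  \sum_(0 <= m < 5) sc A 1 i m * sc A 1 m j =
  sc A 4 i j *+ 2 + \sum_(1 <= l < 4) A 1 1 l *+ 4 * sc A l i j
    + (sc_c A 1 1 *+ 2) * (i == j)%:R.
Proof.
rewrite !sum_0_5 !sum_1_4.
case: i => [|[|[|[|[|//]]]]] _; case: j => [|[|[|[|[|//]]]]] _.
all: rewrite /sc /sc_gen /= /sc_e /sc_d ?sum_1_4.
all: rewrite ?(mul0r, mul1r, mulr0, mulr1, mulr0n, mulr1n, add0r, addr0, mul0rn, subr0).
all: rewrite ?sc_cC.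
all: rewrite ?sA.
all: rewrite ?sc_cE.
all: ring.
Qed.
End Associativity.

Definition sc_mx (K : comNzRingType) (A : nat -> nat -> nat -> K) (k : nat) : 'M[K]_5 :=
  \matrix_(i, j) sc A k i j.

Section Commutation.
Context (K : numFieldType) (A : nat -> nat -> nat -> K).
Hypothesis symA : symmetric3 A.

Lemma sc_comm k i j : (k < 5)%N -> (i < 5)%N -> sc A k i j = sc A i k j.
Proof.
have sC : forall k i, (0 < k < 4)%N -> (0 < i < 4)%N -> sc_c A k i = sc_c A i k.
  by case=> [//|[|[|[|//]]]]; case=> [//|[|[|[|//]]]] //= _ _; rewrite ?(sc_cC symA).
case: k => [|[|[|[|[|//]]]]] _; case: i => [|[|[|[|[|//]]]]] _.
all: rewrite /sc /sc_gen ?(eq_sym j) //.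
all: case: j => [|[|[|[|[|j]]]]] //=; rewrite ?[_ == _]eq_sym ?(sC 1%N) ?(sC 2%N) //.
all: by rewrite (symA _ _ _).1.
Qed.

Lemma sc_mx_mulE k l (i j : 'I_5) :
  (sc_mx A k *m sc_mx A l) i j = \sum_(0 <= m < 5) sc A k i m * sc A l m j.
Proof. by rewrite mxE big_mkord; apply: eq_bigr => m _; rewrite !mxE. Qed.

Lemma sc_mx0 : sc_mx A 0 = 1%:M.
Proof. by apply/matrixP => i j; rewrite !mxE. Qed.

Lemma sc_mx_comm k l : (k < 5)%N -> (l < 5)%N -> comm_mx (sc_mx A k) (sc_mx A l).
Proof.
have base k' l' : (0 < k' < 4)%N -> (0 < l' < 4)%N -> comm_mx (sc_mx A k') (sc_mx A l').
  by move=> k4 l4; apply/matrixP => i j; rewrite !sc_mx_mulE sc_assoc.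
have sq : 2%:R *: sc_mx A 4 = sc_mx A 1 *m sc_mx A 1 -
    (\sum_(1 <= m < 4) (A 1 1 m *+ 4) *: sc_mx A m) - (sc_c A 1 1 *+ 2)%:M.
  apply/matrixP => i j.
  have -> (U V W : 'M[K]_5) : (U - V - W) i j = U i j - V i j - W i j by rewrite !mxE.
  rewrite sc_mx_mulE sc_sqr // summxE !mxE.
  under [X in _ = _ - X - _]eq_bigr do rewrite !mxE.
  by rewrite mulr_natl mulr_natr addrAC !addrK.
have base4 l' : (0 < l' < 4)%N -> comm_mx (sc_mx A 4) (sc_mx A l').
  move=> l4; suff: comm_mx (2%:R *: sc_mx A 4) (sc_mx A l').
    rewrite /comm_mx -scalemxAl -scalemxAr => /scalerI; apply.
    by rewrite pnatr_eq0.
  rewrite sq; apply/comm_mx_sym.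
  apply: comm_mxB; last exact: comm_mx_scalar.
  apply: comm_mxB; first by apply: comm_mxM; apply: base.
  rewrite sum_1_4.
  by do !apply: comm_mxD; rewrite /comm_mx -scalemxAl -scalemxAr base.
move=> k5 l5; case: k k5 => [|k] k5; first by rewrite sc_mx0; exact/comm_mx_sym/comm_mx_scalar.
case: l l5 => [|l] l5; first by rewrite sc_mx0; exact: comm_mx_scalar.
have [k4|] := ltnP k 3; have [l4|] := ltnP l 3.
- exact: base.
- move=> l3; have -> : l = 3%N by apply/eqP; rewrite eqn_leq l3 andbT.
  by apply/comm_mx_sym/base4.
- move=> k3; have -> : k = 3%N by apply/eqP; rewrite eqn_leq k3 andbT.
  exact: base4.
- move=> l3 k3; have -> : k = 3%N by apply/eqP; rewrite eqn_leq k3 andbT.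
  by have -> : l = 3%N by apply/eqP; rewrite eqn_leq l3 andbT.
Qed.

(** The entry (j, l) of either side is the trace of the product of the basis elements j, k and l,
    which does not depend on their order. *)
Lemma sc_mx_adj k : (k < 5)%N ->
  sc_mx A k *m trace_form A = trace_form A *m (sc_mx A k)^T.
Proof.
have trC : (trace_form A)^T = trace_form A.
  apply/matrixP => i j; rewrite !mxE; apply: eq_bigr => l _.
  by rewrite sc_comm.
move=> k5; rewrite -[in RHS]trC -trmx_mul; apply/matrixP => j l.
have E (i m : 'I_5) : (sc_mx A k *m trace_form A) i m =
    \sum_(0 <= p < 5) (\sum_(0 <= q < 5) sc A k i q * sc A m q p) * sc_tr A p.
  rewrite mxE; under [RHS]eq_bigr do rewrite mulr_suml.
  rewrite exchange_big /= [RHS]big_mkord; apply: eq_bigr => q _; rewrite !mxE mulr_sumr.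
  by apply: eq_bigr => p _; rewrite mulrA (@sc_comm q m).
rewrite [RHS]mxE !E; apply: eq_big_nat => p /andP[_ p5]; congr (_ * _).
have C (k' l' i : 'I_5) :  \sum_(0 <= m < 5) sc A k' i m * sc A l' m p =
    \sum_(0 <= m < 5) sc A l' i m * sc A k' m p.
  by have /matrixP/(_ i (Ordinal p5)) := sc_mx_comm (ltn_ord k') (ltn_ord l'); rewrite !sc_mx_mulE.
under eq_bigr do rewrite (sc_comm _ k5) //.
rewrite (C j l (Ordinal k5)) /=.
by apply: eq_bigr => m _; rewrite (sc_comm _ k5).
Qed.
End Commutation.

(** * Positive definite trace forms *)

Definition posdef (R : realFieldType) n (T : 'M[R]_n) : Prop :=
  forall x : 'rV[R]_n, x != 0 -> 0 < (x *m T *m x^T) 0 0.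

Lemma nuniq_perm (U : eqType) (s : seq U) :
  ~~ uniq s -> exists z s', perm_eq s [:: z, z & s'].
Proof.
elim: s => [//|x s IHs] /=; rewrite negb_and negbK => /orP[xs|/IHs[z [s' ps]]].
  by exists x, (rem x s); rewrite perm_cons perm_to_rem.
exists z, (x :: s'); rewrite (perm_trans (_ : perm_eq _ (x :: [:: z, z & s']))) ?perm_cons //.
by rewrite -[x :: _]/([:: x] ++ [:: z; z] ++ s') perm_catCA.
Qed.

Section SelfAdjoint.
Context (R : rcfType) (n : nat) (T M : 'M[R]_n.+1).
Local Notation toC := (map_mx (real_complex R)).
Local Notation conjm := (map_mx (@conjc R)).
Hypothesis posT : posdef T.
Hypothesis symT : T^T = T.
Hypothesis adjM : M *m T = T *m M^T.

Lemma conjm_toC m p (U : 'M[R]_(m, p)) : conjm (toC U) = toC U.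
Proof. by apply/matrixP => i j; rewrite !mxE conjc_real. Qed.

(** For x = u + i v the mixed terms cancel by the symmetry of T, and T(u, u) + T(v, v) remains. *)
Lemma posdef_herm (x : 'rV[R[i]]_n.+1) : x *m toC T *m (conjm x)^T = 0 -> x = 0.
Proof.
pose u := map_mx (@complex.Re R) x; pose v := map_mx (@complex.Im R) x.
have xE : x = toC u + 'i%C *: toC v.
  by apply/matrixP => i j; rewrite !mxE [LHS]complexE.
have cE : conjm x = toC u - 'i%C *: toC v.
  apply/matrixP => i j; rewrite !mxE; case: (x i j) => a b /=.
  by simpc.
clearbody u v.
rewrite cE {1}xE linearB linearZ /= !mulmxDl mulmxBr mulmxBr -!scalemxAl -!scalemxAr scalerA.
have -> : 'i%C * 'i%C = -1 :> R[i] by rewrite -expr2 sqr_i.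
rewrite !map_trmx -!map_mxM /=.
have -> : v *m T *m u^T = u *m T *m v^T.
  have -> : v *m T *m u^T = (v *m T *m u^T)^T.
    by rewrite [v *m T *m u^T]mx11_scalar tr_scalar_mx.
  by rewrite !trmx_mul trmxK symT mulmxA.
rewrite scaleN1r opprK addrA subrK -map_mxD.
move=> /(congr1 (fun m : 'M_1 => complex.Re (m 0 0))) H.
have E : (u *m T *m u^T) 0 0 + (v *m T *m v^T) 0 0 = 0 by move: H; rewrite !mxE.
have pos (w : 'rV_n.+1) : 0 <= (w *m T *m w^T) 0 0.
  by have [->|/posT/ltW//] := eqVneq w 0; rewrite !mul0mx mxE.
have z (w : 'rV_n.+1) : (w *m T *m w^T) 0 0 = 0 -> w = 0.
  by move=> w0; apply/eqP; apply: contraT => /posT; rewrite w0 ltxx.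
have pu := pos u; have pv := pos v.
have u0 : u = 0 by apply: z; lra.
have v0 : v = 0 by apply: z; lra.
by rewrite xE u0 v0 !map_mx0 scaler0 addr0.
Qed.

Lemma conjm_tr_mul m p (U : 'M[R[i]]_(m, n.+1)) (V : 'M[R]_(n.+1, p)) :
  (conjm (U *m toC V))^T = (toC V)^T *m (conjm U)^T.
Proof. by rewrite map_mxM conjm_toC trmx_mul. Qed.

Lemma selfadjoint_toC : toC M *m toC T = toC T *m (toC M)^T.
Proof. by rewrite map_trmx -!map_mxM adjM. Qed.

Lemma eigenvalue_real z : eigenvalue (toC M) z -> z^*%C = z.
Proof.
move=> /eigenvalueP[v vM v0].
have E : v *m toC M *m toC T *m (conjm v)^T = v *m toC T *m (conjm (v *m toC M))^T.
  by rewrite conjm_tr_mul mulmxA -!(mulmxA v) selfadjoint_toC.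
move: E; rewrite vM map_mxZ linearZ /= -!scalemxAl -scalemxAr => /eqP.
rewrite -subr_eq0 -scalerBl scaler_eq0 subr_eq0 => /orP[/eqP//|/eqP /posdef_herm v00].
by rewrite v00 eqxx in v0.
Qed.

(** It suffices that the minimal polynomial has no double root z. If it were q (X - z)^2, then N = M
    - z would be self-adjoint because z is real, and q(M) N N = 0 would make every row of q(M) N
    isotropic for the Hermitian form of T, hence zero, against minimality. *)
Lemma selfadjoint_diagonalizable : diagonalizable (toC M).
Proof.
apply/diagonalizableP; set p := mxminpoly (toC M).
have [rs pE] := closed_field_poly_normal p.
rewrite (monicP (mxminpoly_monic _)) scale1r in pE.
exists rs; last by rewrite -pE.
apply/contraT => /nuniq_perm[z [s' pz]].
have zeig : eigenvalue (toC M) z.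
  by rewrite eigenvalue_root_min -/p pE root_prod_XsubC (perm_mem pz) mem_head.
pose q := \prod_(x <- s') ('X - x%:P); pose N := toC M - z%:M.
have hN : horner_mx (toC M) ('X - z%:P) = N.
  by rewrite rmorphB /= horner_mx_X horner_mx_C.
have pq : p = q * ('X - z%:P) * ('X - z%:P).
  by rewrite pE (perm_big _ pz) !big_cons /= -/q; ring.
have qNN : horner_mx (toC M) q *m N *m N = 0.
  by rewrite -hN !mulmxE -!rmorphM /= -pq mx_root_minpoly.
have NT : N *m toC T = toC T *m N^T.
  by rewrite mulmxBl linearB /= mulmxBr selfadjoint_toC tr_scalar_mx scalar_mxC.
have cN : conjm N = N.
  by rewrite map_mxB conjm_toC map_scalar_mx /= eigenvalue_real.
have qN : horner_mx (toC M) q *m N = 0.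
  apply/row_matrixP => k; rewrite row0; apply: posdef_herm.
  rewrite row_mul map_mxM trmx_mul cN !mulmxA -(mulmxA _ (toC T)) -NT !mulmxA.
  by rewrite -!row_mul qNN ?mul0mx row0 ?mul0mx.
have := mxminpoly_min (p := q * ('X - z%:P)) (A := toC M).
rewrite rmorphM /= hN -mulmxE => /(_ qN) /dvdp_leq.
have q0 : q != 0 by rewrite monic_neq0 // monic_prod_XsubC.
rewrite mulf_neq0 ?polyXsubC_eq0 // => /(_ isT).
rewrite -/p pq size_Mmonic ?monicXsubC ?mulf_neq0 ?polyXsubC_eq0 //.
by rewrite size_XsubC addn2 ltnn.
Qed.
End SelfAdjoint.

Lemma trace_form_sym (K : numFieldType) (A : nat -> nat -> nat -> K) :
  symmetric3 A -> (trace_form A)^T = trace_form A.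
Proof.
move=> symA; apply/matrixP => i j; rewrite !mxE; apply: eq_bigr => l _.
by rewrite (sc_comm symA).
Qed.

Lemma sc_unit (K : comNzRingType) (A : nat -> nat -> nat -> K) k j :
  (k < 5)%N -> sc A k 0 j = (k == j)%:R.
Proof. by case: k => [|[|[|[|[|//]]]]]. Qed.

(** The eigenvalues of the multiplication matrices on a common eigenvector are the coordinates of a
    point. Since row 0 of the k-th matrix is the k-th unit row, that eigenvector is itself a
    multiple of the vector of these eigenvalues; so X inherits its invertibility from the matrix Q
    of eigenvectors. *)
Lemma points_of_posdef (R : rcfType) (A : nat -> nat -> nat -> R) :
  symmetric3 A -> posdef (trace_form A) ->
  exists X : 'M[R]_5, [/\ X \in unitmx, forall i, X i 0 = 1 &
    forall i k j : 'I_5,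
      \sum_(l < 5) sc A k j l * X i l = X i k * X i j].
Proof.
move=> symA posT; pose M (k : 'I_5) := map_mx (real_complex R) (sc_mx A k).
have symT := trace_form_sym symA.
have adjM (k : 'I_5) := sc_mx_adj symA (ltn_ord k).
have [P Pu Pdiag] : codiagonalizable [seq M k | k <- enum 'I_5].
  apply/codiagonalizableP; split.
    move=> _ _ /mapP[k _ ->] /mapP[l _ ->].
    by rewrite /comm_mx -!map_mxM (sc_mx_comm symA).
  by move=> _ /mapP[k _ ->]; apply: (selfadjoint_diagonalizable posT).
pose Q := invmx P; pose d (k i : 'I_5) := (P *m M k *m Q) i i.
have dE k i j : (M k *m Q) j i = Q j i * d k i.
  have /allP/(_ (M k)) := Pdiag; rewrite map_f ?mem_enum // => /(_ isT).
  move=> /(diagonalizable_forP _ Pu) off.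
  rewrite -[M k *m Q]mul1mx -(mulVmx Pu) -mulmxA [P *m _]mulmxA mxE (bigD1 i) //=.
  by rewrite big1 ?addr0 // => m mi; rewrite off ?mulr0.
have dreal k i : (d k i)^*%C = d k i.
  apply: (eigenvalue_real posT symT (adjM k)).
  apply/eigenvalueP; exists (row i P); last first.
    by apply/negP => /eqP r0; move: Pu; rewrite -row_free_unit => /row_freeP[B] /(congr1 (row i)) /eqP;
    rewrite row_mul r0 mul0mx eq_sym row1 => /eqP/matrixP/(_ 0 i);
      rewrite !mxE !eqxx => /eqP; rewrite oner_eq0.
  apply/matrixP => a j; rewrite {a}ord1.
  have /allP/(_ (M k)) := Pdiag; rewrite map_f ?mem_enum // => /(_ isT).
  move=> /(diagonalizable_forP _ Pu) off.
  rewrite -row_mul mxE [RHS]mxE [X in _ = _ * X]mxE -[P *m M k](mulmxKV Pu) mxE (bigD1 i) //=.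
  by rewrite big1 ?addr0 // => m mi; rewrite off ?mul0r // eq_sym.
have Qd k i : Q k i = Q 0 i * d k i.
  rewrite -dE mxE (bigD1 k) //= !mxE sc_unit // eqxx mul1r big1 ?addr0 // => m mk.
  by rewrite !mxE sc_unit // (_ : (_ == _) = false) ?mul0r // eq_sym; apply/negbTE.
have Qu : Q \in unitmx by rewrite unitmx_inv.
have Q0 i : Q 0 i != 0.
  apply/eqP => Q0i; have /matrixP/(_ i i) := mulVmx Qu.
  rewrite mxE big1 => [|m _]; last by rewrite Qd Q0i mul0r mulr0.
  by rewrite mxE eqxx => /esym/eqP; rewrite oner_eq0.
pose X := \matrix_(i, k) complex.Re (d k i).
have Xd i k : (X i k)%:C%C = d k i.
  by rewrite mxE; have := dreal k i; case: (d k i) => a b [] /eqP; rewrite eqNr => /eqP ->.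
have QX : Q = (map_mx (real_complex R) X)^T *m diag_mx (row 0 Q).
  apply/matrixP => k i; rewrite mul_mx_diag [RHS]mxE [_^T _ _]mxE [map_mx _ _ _ _]mxE.
  by rewrite Xd [row _ _ _ _]mxE mulrC -Qd.
exists X; split => [|i|i k j].
- move: Qu; rewrite !unitmxE !unitfE {1}QX det_mulmx mulf_eq0 negb_or => /andP[+ _].
  by rewrite det_tr det_map_mx fmorph_eq0.
- by apply: (@complexI R); rewrite Xd; apply: (mulfI (Q0 i)); rewrite -Qd mulr1.
- apply: (@complexI R); rewrite rmorph_sum rmorphM /= !Xd; apply: (mulfI (Q0 i)).
  rewrite [RHS]mulrCA -(Qd j) [RHS]mulrC -dE mxE mulr_sumr; apply: eq_bigr => l _.
  by rewrite rmorphM /= mulrCA Xd -Qd !mxE.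
Qed.

(** * Ideals of points and apolarity *)

(* The restriction of a polynomial to the line spanned by p, as a polynomial in
   the parameter of the line. *)
Notation ray p := (mmap (@polyC _) (fun j => (p : 'rV__) 0 j *: 'X)).

Lemma poly_eq0_horner (K : numFieldType) (p : {poly K}) :
  (forall t, t != 0 -> p.[t] = 0) -> p = 0.
Proof.
move=> p0; apply/eqP; apply: contraT => pn0.
have := max_poly_roots (rs := [seq n.+1%:R | n <- iota 0 (size p)]) pn0.
rewrite size_map size_iota ltnn => -> //.
  by apply/allP => _ /mapP[n _ ->]; rewrite /root p0 // pnatr_eq0.
rewrite map_inj_uniq ?iota_uniq // => m n /eqP.
by rewrite eqr_nat => /eqP [].
Qed.

Section Ray.
Context (K : numFieldType) (n : nat) (p : 'rV[K]_n).
Implicit Types g : mpoly n K.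

Lemma horner_ray g t : (ray p g).[t] = meval (fun j => t * p 0 j) g.
Proof.
rewrite /mmap horner_sum mevalE; apply: eq_bigr => m _; rewrite hornerM hornerC.
rewrite horner_prod; congr (_ * _); apply: eq_bigr => j _.
by rewrite horner_exp hornerZ hornerX mulrC.
Qed.

Lemma ray_mpolyX m : ray p (mpolyX K m) = meval (p 0) (mpolyX K m) *: 'X^(mdeg m).
Proof.
rewrite mmapX mevalX /mmap1 mdegE.
rewrite (eq_bigr (fun i => p 0 i ^+ m i *: 'X^(m i))) => [|i _]; last exact: exprZn.
elim/big_rec3: _ => [|i q s r _ ->]; first by rewrite expr0 scale1r.
by rewrite -scalerAl -scalerAr scalerA -exprD.
Qed.

Lemma ray_sum (I : Type) (s : seq I) (P : pred I) (c : I -> K) (F : I -> mpoly n K) :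
  ray p (\sum_(i <- s | P i) c i *: F i) = \sum_(i <- s | P i) c i *: ray p (F i).
Proof. by rewrite rmorph_sum; apply: eq_bigr => i _; rewrite /= mmapZ mul_polyC. Qed.

Lemma ray_pihomog d g : ray p (pihomog mdeg d g) = meval (p 0) (pihomog mdeg d g) *: 'X^d.
Proof.
rewrite ray_sum rmorph_sum scaler_suml; apply: eq_bigr => m /eqP <-.
by rewrite ray_mpolyX /= mevalZ scalerA.
Qed.

Lemma ray_dhomog d g : g \is ishomog1 d mdeg -> ray p g = meval (p 0) g *: 'X^d.
Proof. by move=> /pihomog_dE <-; rewrite ray_pihomog. Qed.

Lemma coef_ray d g : (ray p g)`_d = meval (p 0) (pihomog mdeg d g).
Proof.
rewrite {1}(mpolyE g) ray_sum coef_sum rmorph_sum /= [RHS]big_mkcond /=.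
apply: eq_bigr => m _; rewrite ray_mpolyX /= !coefZ coefXn mevalZ eq_sym.
by case: eqP; rewrite ?mulr1 // !mulr0.
Qed.
End Ray.

Section IdealOfPoints.
Context (R : realType) (r : nat) (p : 'I_r -> 'rV[R[i]]_5).
Local Notation I := (ideal_of_points p).

Lemma ideal_of_pointsP g : I g <-> forall i, ray (p i) g = 0.
Proof.
split=> [Ig i|Ig i t]; last by rewrite -horner_ray Ig horner0.
by apply: poly_eq0_horner => t _; rewrite horner_ray; apply: Ig.
Qed.

Lemma homogeneous_ideal_of_points : homogeneous_ideal I.
Proof.
split.
- by apply/ideal_of_pointsP => i; rewrite rmorph0.
- move=> g h /ideal_of_pointsP Ig /ideal_of_pointsP Ih; apply/ideal_of_pointsP => i.
  by rewrite rmorphD /= Ig Ih addr0.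
- move=> g h /ideal_of_pointsP Ih; apply/ideal_of_pointsP => i.
  by rewrite rmorphM /= Ih mulr0.
- move=> g d /ideal_of_pointsP Ig; apply/ideal_of_pointsP => i.
  by rewrite ray_pihomog -coef_ray Ig coef0 scale0r.
Qed.
End IdealOfPoints.

Section IndependentPoints.
Context (R : realType) (X : 'M[R[i]]_5).
Hypothesis Xu : X \in unitmx.
Hypothesis X1 : forall i, X i 0 = 1.
Let p (i : 'I_5) := row i X.
Local Notation I := (ideal_of_points p).

Lemma dhomog_var k : var R k \is ishomog1 1 mdeg.
Proof. by rewrite dhomogX; apply/eqP; exact: mdeg1. Qed.

Lemma meval_var (v : 'I_5 -> R[i]) k : meval v (var R k) = v (inord k.-1).
Proof. exact: mevalXU. Qed.

Lemma ray_var1 i : ray (p i) (var R 1) = 'X.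
Proof.
rewrite (ray_dhomog _ (dhomog_var 1)) meval_var mxE expr1.
by rewrite (_ : inord _ = 0) ?X1 ?scale1r //; apply/val_inj; rewrite /= inordK.
Qed.

Definition dual_form (i : 'I_5) : poly5 R :=
  \sum_(j < 5) invmx X j i *: mpolyX R[i] (mnm1 j).

Lemma dhomog_dual i : dual_form i \is ishomog1 1 mdeg.
Proof. by apply: rpred_sum => j _; apply: rpredZ; rewrite dhomogX; apply/eqP; exact: mdeg1. Qed.

Lemma meval_dual (v : 'rV[R[i]]_5) i : meval (v 0) (dual_form i) = (v *m invmx X) 0 i.
Proof.
by rewrite rmorph_sum mxE; apply: eq_bigr => j _; rewrite /= mevalZ mevalXU mulrC.
Qed.

Lemma ray_dual i k : ray (p k) (dual_form i) = (k == i)%:R *: 'X.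
Proof.
by rewrite (ray_dhomog _ (dhomog_dual i)) meval_dual -row_mul mulmxV // !mxE.
Qed.

Lemma saturated_independent : saturated I.
Proof.
move=> g k Hg; apply/ideal_of_pointsP => i.
have /Hg/ideal_of_pointsP/(_ i) : var R 1 ^+ k \is ishomog1 k mdeg.
  by rewrite -[k in ishomog1 k]mul1n dhomogMn ?dhomog_var.
rewrite rmorphM rmorphXn /= ray_var1 => /eqP.
by rewrite mulf_eq0 expf_eq0 polyX_eq0 andbF => /eqP.
Qed.

Lemma quotient_dim_independent d : (0 < d)%N -> quotient_dim I d 5.
Proof.
(* Modulo the ideal a form is determined by its values at the five points, and these forms have the
   Kronecker delta as values because y_1 is 1 at each point. *)
move=> d0; exists (fun i => var R 1 ^+ d.-1 * dual_form i).
have hom i : var R 1 ^+ d.-1 * dual_form i \is ishomog1 d mdeg.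
  have -> : ishomog1 d mdeg = @ishomog1 5 R[i] (1 * d.-1 + 1) mdeg.
    by rewrite mul1n addn1 prednK.
  by rewrite dhomogM ?dhomogMn ?dhomog_var ?dhomog_dual.
split=> // g gd.
have rayE (c : 'rV_5) k :
    ray (p k) (g - \sum_(i < 5) c 0 i *: (var R 1 ^+ d.-1 * dual_form i)) =
    (meval (p k 0) g - c 0 k) *: 'X^d.
  rewrite rmorphB /= (ray_dhomog _ gd) ray_sum (bigD1 k) //= big1 => [|i ik].
    rewrite addr0 rmorphM rmorphXn /= ray_var1 ray_dual eqxx scale1r -exprSr prednK //.
    by rewrite scalerBl.
  by rewrite rmorphM /= ray_dual eq_sym (negbTE ik) scale0r mulr0 scaler0.
exists (\row_k meval (p k 0) g); split=> [|c /ideal_of_pointsP Ic].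
  by apply/ideal_of_pointsP => k; rewrite rayE mxE subrr scale0r.
apply/rowP => k; rewrite mxE; have /eqP := Ic k.
by rewrite rayE scaler_eq0 expf_eq0 polyX_eq0 andbF orbF subr_eq0 => /eqP.
Qed.

Lemma finite_subscheme_independent : finite_subscheme 5 I.
Proof.
split; [exact: homogeneous_ideal_of_points|exact: saturated_independent|].
by exists 1%N => d; apply: quotient_dim_independent.
Qed.

Lemma disjoint_independent : disjoint_from_y1 I.
Proof.
move=> q q0 Iq; rewrite meval_var.
have -> : inord 0 = 0 :> 'I_5 by apply/val_inj; rewrite /= inordK.
pose c := q *m invmx X.
(* Products of two distinct dual forms lie in the ideal, so a common zero q is a multiple of a
   single point. *)
have cc i j : i != j -> c 0 i * c 0 j = 0.
  move=> ij; rewrite -!meval_dual -rmorphM; apply: Iq.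
  apply/ideal_of_pointsP => k; rewrite rmorphM /= !ray_dual -scalerAl -scalerAr scalerA.
  have [->|_] := eqVneq k i; last by rewrite mul0r scale0r.
  by rewrite (negbTE ij) mulr0 scale0r.
have qc : q = c *m X by rewrite mulmxKV.
have [i ci] : exists i, c 0 i != 0.
  apply/existsP; apply: contraR q0; rewrite negb_exists => /forallP c0.
  rewrite qc (_ : c = 0) ?mul0mx //; apply/rowP => i; rewrite [RHS]mxE.
  by apply/eqP; have := c0 i; rewrite negbK.
rewrite qc mxE (bigD1 i) //= big1 => [|j ji].
  by rewrite X1 addr0 mulr1.
have /eqP := cc _ _ ji; rewrite mulf_eq0 (negbTE ci) orbF => /eqP ->.
by rewrite mul0r.
Qed.
End IndependentPoints.

Lemma sum_inord5 (K : nmodType) (F : 'I_5 -> K) :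
  \sum_(j < 5) F j = \sum_(0 <= j < 5) F (inord j).
Proof. by rewrite big_mkord; apply: eq_bigr => j _; rewrite inord_val. Qed.

(* Twice the Gram matrix of the quadric x_1 x_5 + x_2^2 + x_3^2 + x_4^2. *)
Definition polar (K : nzRingType) (j k : nat) : K :=
  match j, k with
  | 0%N, 4%N | 4%N, 0%N => 1
  | 1%N, 1%N | 2%N, 2%N | 3%N, 3%N => 2
  | _, _ => 0
  end.

Lemma polar_sum (K : numFieldType) (L : comAlgType K) (y : nat -> L) :
  \sum_(0 <= j < 5) \sum_(0 <= k < 5) (2^-1 * polar K j k) *: (y j * y k) =
    y 0%N * y 4%N + y 1%N ^+ 2 + y 2%N ^+ 2 + y 3%N ^+ 2.
Proof.
rewrite !sum_0_5 /= mulr0 !scale0r !add0r !addr0 mulr1.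
rewrite mulVf ?pnatr_eq0 // !scale1r !expr2 -!addrA.
rewrite (mulrC (y 4%N)) [RHS]addrC [LHS]addrC -!addrA -scalerDl.
have -> : 2^-1 + 2^-1 = 1 :> K by rewrite [RHS]splitr mul1r.
by rewrite scale1r.
Qed.

Section Apolarity.
Context (R : realType).
Implicit Types (g h : poly5 R) (v : 'rV[R[i]]_5).
Local Notation C := R[i].

Lemma mnm_succ (m : multinom 5) : mdeg m != 0%N ->
  exists i m', m = mnm_add (mnm1 i) m' /\ mdeg m = (mdeg m').+1.
Proof.
move=> m0; have [i mi] : exists i, m i != 0%N.
  apply/existsP; apply: contraR m0; rewrite negb_exists => /forallP m0.
  by rewrite mdegE big1 // => i _; apply/eqP; have := m0 i; rewrite negbK.
exists i, (mnm_sub m (mnm1 i)).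
have E : m = mnm_add (mnm1 i) (mnm_sub m (mnm1 i)) by rewrite addmC submK // lep1mP.
by split=> //; rewrite {1}E mdegD mdeg1.
Qed.

Lemma mderivm_const (m : multinom 5) (c : C) :
  mderivm m (mpolyC 5 c) = mpolyC 5 (if mdeg m == 0%N then c else 0).
Proof.
case: ifP => [|/negbT/mnm_succ[i [m' [-> _]]]].
  by rewrite mdeg_eq0 => /eqP ->; rewrite mderivm0m.
by rewrite mderivmDm mderivmU1m mderivC linear0 mpolyC0.
Qed.

Lemma mderiv_linear_form i v : mderiv i (linear_form v) = mpolyC 5 (v 0 i).
Proof.
rewrite linear_sum (bigD1 i) //= big1 => [|j ji].
  by rewrite addr0 mderivZ mderivX mnm1E eqxx scale1r -{1}[mnm1 i]add0m addmK mpolyX0 alg_mpolyC.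
by rewrite mderivZ mderivX mnm1E (negbTE ji) scale0r scaler0.
Qed.

Lemma mderivm_linear_form m v :
  mderivm m (linear_form v) =
    (mdeg m == 0%N)%:R *: linear_form v
    + ((mdeg m == 1%N)%:R * meval (v 0) (mpolyX C m)) *: 1.
Proof.
have [|/mnm_succ[i [m' [-> _]]]] := eqVneq (mdeg m) 0%N.
  move/eqP; rewrite mdeg_eq0 => /eqP ->.
  by rewrite mderivm0m mdeg0 mul0r scale0r addr0 scale1r.
rewrite mderivmDm mderivmU1m mderiv_linear_form mderivm_const mdegD mdeg1 add1n eqSS.
rewrite scale0r add0r mpolyXD rmorphM /= mevalXU alg_mpolyC.
case: eqP => [/eqP|_]; last by rewrite mul0r.
by rewrite mdeg_eq0 => /eqP ->; rewrite mpolyX0 meval1 mulr1 mul1r.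
Qed.

Lemma mderivm_sqr m v :
  mderivm m (linear_form v ^+ 2) =
    ((mdeg m == 0%N)%:R * meval (v 0) (mpolyX C m)) *: linear_form v ^+ 2
    + (((mdeg m == 1%N)%:R * meval (v 0) (mpolyX C m)) *: linear_form v
    + ((mdeg m == 2%N)%:R * meval (v 0) (mpolyX C m)) *: 1) *+ 2.
Proof.
have [|/mnm_succ[i [m' [-> _]]]] := eqVneq (mdeg m) 0%N.
  move/eqP; rewrite mdeg_eq0 => /eqP ->.
  by rewrite mderivm0m mdeg0 !mul0r !scale0r addr0 mul0rn addr0 mpolyX0 meval1 mulr1 scale1r.
rewrite mderivmDm mderivmU1m expr2 mderivM mderiv_linear_form.
rewrite [linear_form v * _]mulrC -mulr2n mderivmMn mul_mpolyC mderivmZ mderivm_linear_form.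
rewrite mdegD mdeg1 add1n !eqSS mul0r scale0r add0r mpolyXD rmorphM /= mevalXU.
congr (_ *+ 2); rewrite scalerDr !scalerA; congr (_ *: _ + _ *: _); last by rewrite mulrCA.
case: eqP => [/eqP|_]; last by rewrite mulr0 !mul0r.
by rewrite mdeg_eq0 => /eqP ->; rewrite mpolyX0 meval1 !mulr1 mul1r.
Qed.

(** A monomial operator of degree d sends l^2 to its value at v times 2!/(2-d)! l^(2-d). So l^2 is
    annihilated by every g that vanishes on the line of v, which is the easy half of the apolarity
    lemma. *)
Lemma diff_act_sqr g v :
  diff_act g (linear_form v ^+ 2) =
    meval (v 0) (pihomog mdeg 0 g) *: linear_form v ^+ 2
    + (meval (v 0) (pihomog mdeg 1 g) *: linear_form v
    + meval (v 0) (pihomog mdeg 2 g) *: 1) *+ 2.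
Proof.
have E d : meval (v 0) (pihomog mdeg d g) =
    \sum_(m <- msupp g) mcoeff m g * ((mdeg m == d)%:R * meval (v 0) (mpolyX C m)).
  rewrite rmorph_sum /= big_mkcond; apply: eq_bigr => m _ /=; rewrite mevalZ.
  by case: eqP; rewrite ?mul1r // mul0r mulr0.
rewrite !E !scaler_suml -big_split /= -sumrMnl -big_split /=.
apply: eq_bigr => m _; rewrite mderivm_sqr scalerDr scalerA; congr (_ + _).
by rewrite -scalerMnr scalerDr !scalerA.
Qed.

Lemma diff_act_sum g (c : 'I_5 -> C) (h : 'I_5 -> poly5 R) :
  diff_act g (\sum_i c i *: h i) = \sum_i c i *: diff_act g (h i).
Proof.
rewrite /diff_act; under [RHS]eq_bigr do rewrite scaler_sumr.
rewrite exchange_big; apply: eq_bigr => m _ /=.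
rewrite linear_sum scaler_sumr; apply: eq_bigr => i _ /=.
by rewrite mderivmZ !scalerA mulrC.
Qed.

Lemma ideal_of_points_apolar (p : 'I_5 -> 'rV[C]_5) (c : 'I_5 -> C) g :
  ideal_of_points p g ->
  annihilator (\sum_i c i *: linear_form (p i) ^+ 2) g.
Proof.
move=> /ideal_of_pointsP Ig; rewrite /annihilator /= diff_act_sum big1 // => i _.
by rewrite diff_act_sqr -!coef_ray !Ig !coef0 !scale0r addr0 mul0rn addr0 scaler0.
Qed.

Lemma quadricE (X : 'M[C]_5) (c : 'I_5 -> C) :
  (forall j k : 'I_5, \sum_i c i * X i j * X i k = 2^-1 * polar C j k) ->
  quadric R = \sum_i c i *: linear_form (row i X) ^+ 2.
Proof.
move=> H; pose x (j : 'I_5) : poly5 R := mpolyX C (mnm1 j).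
have -> : \sum_i c i *: linear_form (row i X) ^+ 2 =
    \sum_(j < 5) \sum_(k < 5) (2^-1 * polar C j k) *: (x j * x k).
  under eq_bigr => i _.
    rewrite /linear_form expr2 mulr_suml scaler_sumr.
    under eq_bigr => j _.
      rewrite mulr_sumr scaler_sumr.
      under eq_bigr => k _ do rewrite -scalerAl -scalerAr !scalerA !mxE.
    over.
  over.
  rewrite exchange_big; apply: eq_bigr => j _; rewrite exchange_big; apply: eq_bigr => k _ /=.
  by rewrite -scaler_suml H.
pose y j := var R j.+1.
have -> : \sum_(j < 5) \sum_(k < 5) (2^-1 * polar C j k) *: (x j * x k) =
    \sum_(0 <= j < 5) \sum_(0 <= k < 5) (2^-1 * polar C j k) *: (y j * y k).
  rewrite big_mkord; apply: eq_bigr => j _; rewrite big_mkord; apply: eq_bigr => k _.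
  by rewrite /y /var /= !inord_val.
have -> : quadric R = y 0%N * y 4%N + y 1%N ^+ 2 + y 2%N ^+ 2 + y 3%N ^+ 2.
  by rewrite /quadric /y; reflexivity.
exact/esym/polar_sum.
Qed.
End Apolarity.

(** * The affine patch *)

(* A quarter of the coordinates a_ijk, with 2, 3, 4 renumbered as 1, 2, 3. *)
Definition tensor (K : fieldType) (a : 'rV[K]_10) (i j k : nat) : K :=
  4^-1 * a 0 (coord_index i.+1 j.+1 k.+1).

Lemma symmetric3_tensor (K : fieldType) (a : 'rV[K]_10) : symmetric3 (tensor a).
Proof.
have leq_sort s t : perm_eq s t -> sort leq s = sort leq t.
  by move/(perm_sortP leq_total leq_trans anti_leq).
move=> i j k; rewrite /tensor /coord_index; split; congr (_ * a 0 (inord (index _ _))).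
  by apply: leq_sort; rewrite -[[:: i.+1; _; _]]/([:: i.+1] ++ [:: j.+1] ++ [:: k.+1]) perm_catCA.
by apply: leq_sort; rewrite perm_cons -[[:: j.+1; _]]/([:: j.+1] ++ [:: k.+1]) perm_catC.
Qed.

Definition polar_mx (K : nzRingType) : 'M[K]_5 := \matrix_(j, k) polar K j k.

(** The table [sc_gen] is shaped for this: c occurs both in y_k y_i and in y_5 y_m, and d both in
    y_5 y_m and in y_5 y_5, with factors 2 wherever the polar form pairs 1 with y_5 by 1 and y_m
    with itself by 2. *)
Lemma sc_polar (K : numFieldType) (A : nat -> nat -> nat -> K) k : symmetric3 A ->
  (k < 5)%N -> sc_mx A k *m polar_mx K = polar_mx K *m (sc_mx A k)^T.
Proof.
move=> symA k5; have polarC (i j : nat) : polar K i j = polar K j i.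
  by case: i j => [|[|[|[|[|i]]]]] [|[|[|[|[|j]]]]].
have E (i j : 'I_5) : (sc_mx A k *m polar_mx K) i j = \sum_(0 <= m < 5) sc A k i m * polar K m j.
  by rewrite mxE big_mkord; apply: eq_bigr => m _; rewrite !mxE.
have polT : (polar_mx K)^T = polar_mx K by apply/matrixP => i j; rewrite !mxE polarC.
rewrite -[in RHS]polT -trmx_mul; apply/matrixP => i j; rewrite [RHS]mxE !E !sum_0_5.
have cC := sc_cC symA; have aC := symmetric3_sort symA.
case: i j => [i i5] [j j5] /=.
case: k k5 {E} => [|[|[|[|[|//]]]]] _; case: i i5 => [|[|[|[|[|//]]]]] _.
all: case: j j5 => [|[|[|[|[|//]]]]] _ //.
all: by rewrite /sc /sc_gen /= ?cC ?aC; ring.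
Qed.

Lemma tensorMn4 (K : numFieldType) (a : 'rV[K]_10) i j k :
  tensor a i j k *+ 4 = a 0 (coord_index i.+1 j.+1 k.+1).
Proof. by rewrite /tensor -[LHS]mulr_natl mulrA mulfV ?mul1r // pnatr_eq0. Qed.

Lemma sc_tensor (K : numFieldType) (a : 'rV[K]_10) (x : nat -> K) i j :
  (2 <= i)%N -> (i <= j)%N -> (j <= 4)%N -> x 0%N = 1 ->
  \sum_(0 <= l < 5) sc (tensor a) i.-1 j.-1 l * x l =
    (if i == j then 2 else 0) * x 4%N
    + \sum_(1 <= m < 4) a 0 (coord_index i j m.+1) * x m + sc_c (tensor a) i.-1 j.-1 *+ 2.
Proof.
rewrite sum_0_5 sum_1_4 => i2 ij j4 ->.
have := leq_trans ij j4.
case: i i2 ij => [|[|[|[|[|i]]]]] // _; case: j j4 => [|[|[|[|[|j]]]]] // _ _ _.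
all: rewrite /sc /sc_gen /= !tensorMn4 ?mul0rn mulr1 [LHS]addrC; congr (_ + _).
all: by rewrite [RHS]addrC !addrA.
Qed.

(** The factors [t * 1] match the evaluation of a patch quadric at t times a point with first
    coordinate 1. *)
Lemma scaled_relation (K : comNzRingType) (t x y b z s c : K) :
  x * y = b * z + s + c ->
  t * x * (t * y) - b * (t * 1 * (t * z)) - t * t * s - c * (t * 1) ^+ 2 = 0.
Proof. by move=> E; rewrite mulrACA E; ring. Qed.

Section Patch.
Context (R : realType).
Local Notation C := R[i].
Local Notation toC := (map_mx (real_complex R)).

Lemma meval_patch_quadric (v : 'I_5 -> C) (i j : nat) (u : nat -> C) (b c : C) :
  meval v (var R i * var R j - b *: (var R 1 * var R 5)
    - \sum_(2 <= k < 5) u k *: (var R 1 * var R k) - c *: var R 1 ^+ 2) =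
  v (inord i.-1) * v (inord j.-1) - b * (v 0 * v (inord 4))
    - \sum_(1 <= k < 4) u k.+1 * (v 0 * v (inord k)) - c * v 0 ^+ 2.
Proof.
have -> : 0 = inord 0 :> 'I_5 by apply/val_inj; rewrite /= inordK.
rewrite !rmorphB rmorphM /= !mevalZ rmorphM rmorphXn /= !meval_var.
rewrite rmorph_sum /= big_add1 /=; congr (_ - _ - _ - _); apply: eq_big_nat => k _.
by rewrite mevalZ rmorphM /= !meval_var.
Qed.

(** In the basis of the five points the polar form has matrix W. Multiplication by each coordinate
    is diagonal there and self-adjoint for W, and the points are distinct, so W is diagonal. Halves
    of its diagonal entries are the coefficients of a decomposition of the quadric. *)
Lemma SSP_patch_posdef (a : 'rV[R]_10) :
  posdef (trace_form (tensor a)) -> SSP_patch (quadric R) a.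
Proof.
have symA := symmetric3_tensor a.
move=> /(points_of_posdef symA)[X [Xu X1 Xmul]].
pose W := invmx X^T *m polar_mx R *m invmx X.
have XtU : X^T \in unitmx by rewrite unitmx_tr.
have WE : X^T *m W *m X = polar_mx R by rewrite !mulmxA mulmxV // mul1mx mulmxKV.
clearbody W; pose D (k : 'I_5) := diag_mx (\row_i X i k).
have MX (k : 'I_5) : sc_mx (tensor a) k *m X^T = X^T *m D k.
  apply/matrixP => j i; rewrite mul_mx_diag !mxE mulrC -Xmul.
  by apply: eq_bigr => l _; rewrite !mxE.
have XM (k : 'I_5) : X *m (sc_mx (tensor a) k)^T = D k *m X.
  by rewrite -[LHS]trmxK trmx_mul trmxK MX trmx_mul tr_diag_mx trmxK.
have DW (k : 'I_5) : D k *m W = W *m D k.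
  have := sc_polar symA (ltn_ord k); rewrite -WE !mulmxA MX -!mulmxA XM !mulmxA.
  move=> /(can_inj (mulmxK Xu)); rewrite -!mulmxA.
  exact: (can_inj (mulKmx XtU)).
(* A nonzero entry would give two points the same coordinates, hence X two equal rows. *)
have Woff i j : i != j -> W i j = 0.
  move=> ij; apply/eqP; apply: contraR ij => Wij.
  have Xij k : X i k = X j k.
    have /matrixP/(_ i j) := DW k; rewrite mul_diag_mx mul_mx_diag !mxE.
    by rewrite mulrC => /(mulfI Wij).
  have /matrixP/(_ i j) := mulmxV Xu; have /matrixP/(_ j j) := mulmxV Xu.
  rewrite !mxE eqxx; under [X in _ -> X = _ -> _]eq_bigr do rewrite Xij.
  by move=> ->; case: eqP => // _ /eqP; rewrite oner_eq0.
have polarE j k : \sum_i W i i * X i j * X i k = polar R j k.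
  have /matrixP/(_ j k) := WE; rewrite [RHS]mxE => <-; rewrite mxE.
  apply: eq_bigr => i _; rewrite mxE (bigD1 i) //= big1 => [|m mi].
    by rewrite addr0 mxE [X i j * _]mulrC.
  by rewrite Woff // mulr0.
pose Xc := toC X.
have Xcu : Xc \in unitmx by rewrite map_unitmx.
have Xc1 i : Xc i 0 = 1 by rewrite mxE X1.
have rowE i : complexify (row i X) = row i Xc by rewrite /complexify map_row.
pose lam i : C := (2^-1 * W i i)%:C%C.
have quadE : quadric R = \sum_(i < 5) lam i *: linear_form (row i Xc) ^+ 2.
  apply: quadricE => j k; transitivity ((2^-1 * polar R j k)%:C%C).
    rewrite -polarE mulr_sumr rmorph_sum; apply: eq_bigr => i _.
    by rewrite !mxE -!rmorphM /= !mulrA.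
  rewrite rmorphM fmorphV rmorph_nat; congr (_ * _).
  by case: j k => [[|[|[|[|[|j]]]]] ?] [[|[|[|[|[|k]]]]] ?]; rewrite /= ?rmorph0 ?rmorph1 ?rmorph_nat.
pose I := ideal_of_points (fun i => row i Xc).
have VI : VSP (quadric R) I.
  split; first exact: finite_subscheme_independent.
  by move=> g; rewrite quadE; apply: ideal_of_points_apolar.
exists I; split.
- split=> //; exists (fun i => row i X), lam; split.
  + move=> i; apply/eqP => ri0; have := X1 i.
    by have /rowP/(_ 0) := ri0; rewrite !mxE => -> /esym/eqP; rewrite oner_eq0.
  + by rewrite quadE; apply: eq_bigr => i _; rewrite rowE.
  + by congr ideal_of_points; apply/funext => i; rewrite rowE.
- by split=> //; apply: disjoint_independent.
- move=> i j i2 ij j4; exists (sc_c (tensor a) i.-1 j.-1 *+ 2)%:C%C => k t.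
  pose x m := X k (inord m).
  have x0 : X k 0 = 1 by [].
  have rel : x i.-1 * x j.-1 = (if i == j then 2 else 0) * x 4%N
      + \sum_(1 <= m < 4) a 0 (coord_index i j m.+1) * x m + sc_c (tensor a) i.-1 j.-1 *+ 2.
    rewrite -(sc_tensor a (x := x)) //; last first.
      by rewrite -(X1 k); congr (X k _); apply/val_inj; rewrite /= inordK.
    have i5 : (i.-1 < 5)%N by move: (leq_trans ij j4); case: (i) => [|[|[|[|[|]]]]].
    have j5 : (j.-1 < 5)%N by move: j4; case: (j) => [|[|[|[|[|]]]]].
    rewrite /x -Xmul sum_inord5 !inordK //; apply: eq_big_nat => l /andP[_ l5].
    by rewrite inordK.
  have b2 : (if i == j then 2 else 0) = ((if i == j then 2 else 0) : R)%:C%C.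
    by case: eqP => _; rewrite ?rmorph0 ?rmorph_nat.
  have XcE m : row k Xc 0 m = (X k m)%:C%C by rewrite !mxE.
  rewrite meval_patch_quadric !XcE X1 rmorph1 b2 -!/(x _).
  rewrite (eq_big_nat _ _ (F2 := fun m =>
    t * t * (a 0 (coord_index i j m.+1) * x m)%:C%C)) => [|m _]; last first.
    by rewrite XcE rmorphM /= -/(x m) [complexify _ _ _]mxE; ring.
  rewrite -mulr_sumr -rmorph_sum; apply: scaled_relation.
  by rewrite -!rmorphM -!rmorphD /= rel.
Qed.
End Patch.

(* Five independent points with the multiplication table prescribed by A and
   orthogonal for the polar form: the remaining structure constants of their
   coordinate ring are forced by associativity. *)
Section Forced.
Context (R : realFieldType) (A : nat -> nat -> nat -> R).
Context (x : 'I_5 -> nat -> R) (w : 'I_5 -> R) (c : nat -> nat -> R).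
Hypothesis symA : symmetric3 A.
Let X := \matrix_(m, j < 5) x m j.
Hypothesis Xu : X \in unitmx.
Hypothesis x0 : forall m, x m 0 = 1.
Hypothesis polarE : forall j k, (j < 5)%N -> (k < 5)%N ->
  \sum_m w m * x m j * x m k = polar R j k.
Hypothesis mulE : forall m i j, (0 < i < 4)%N -> (0 < j < 4)%N ->
  x m i * x m j = (i == j)%:R *+ 2 * x m 4
    + \sum_(1 <= l < 4) A i j l *+ 4 * x m l + c i j *+ 2.

(** The structure constants of the algebra of functions on the five points, found by interpolation
    in the basis of coordinate functions. *)
Let s k i j := \sum_m x m k * x m i * invmx X^T m (inord j).

Lemma forced_uniq (u v : nat -> R) :
  (forall m, \sum_(0 <= j < 5) u j * x m j = \sum_(0 <= j < 5) v j * x m j) ->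
  forall j, (j < 5)%N -> u j = v j.
Proof.
move=> uv j j5; pose U (f : nat -> R) : 'rV_5 := \row_k f k.
have UX f m : (U f *m X^T) 0 m = \sum_(0 <= j < 5) f j * x m j.
  by rewrite mxE big_mkord; apply: eq_bigr => k _; rewrite !mxE.
have XtU : X^T \in unitmx by rewrite unitmx_tr.
have : U u = U v.
  apply: (can_inj (mulmxK XtU)); apply/rowP => m; rewrite !UX; exact: uv.
by move=> /rowP/(_ (Ordinal j5)); rewrite !mxE.
Qed.

Lemma forced_mul k i m : \sum_(0 <= j < 5) s k i j * x m j = x m k * x m i.
Proof.
have XtU : X^T \in unitmx by rewrite unitmx_tr.
have YX n : \sum_(j < 5) invmx X^T n (inord j) * x m j = (n == m)%:R.
  have /matrixP/(_ n m) := mulVmx XtU; rewrite !mxE => <-.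
  by apply: eq_bigr => j _; rewrite !mxE inord_val.
rewrite big_mkord; under eq_bigr do rewrite mulr_suml.
rewrite exchange_big /= (eq_bigr (fun n => x n k * x n i * (n == m)%:R)) => [|n _].
  rewrite (bigD1 m) //= eqxx mulr1 big1 ?addr0 // => n /negbTE ->.
  by rewrite mulr0.
by rewrite -YX mulr_sumr; apply: eq_bigr => j _; rewrite mulrA.
Qed.

Lemma forcedC k i j : s k i j = s i k j.
Proof. by apply: eq_bigr => m _; rewrite (mulrC (x m k)). Qed.

Lemma forced_assoc k l i j : (j < 5)%N ->
  \sum_(0 <= m < 5) s k i m * s l m j = \sum_(0 <= m < 5) s l i m * s k m j.
Proof.
have E k' l' i' p : \sum_(0 <= j < 5) (\sum_(0 <= m < 5) s k' i' m * s l' m j) * x p j =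
    x p k' * x p l' * x p i'.
  under eq_bigr do rewrite mulr_suml.
  rewrite exchange_big /=.
  under eq_bigr => m _.
    under eq_bigr do rewrite -mulrA.
    rewrite -mulr_sumr forced_mul mulrCA.
  over.
  by rewrite -mulr_sumr forced_mul; ring.
apply: (forced_uniq (u := fun j => \sum_(0 <= m < 5) s k i m * s l m j)
  (v := fun j => \sum_(0 <= m < 5) s l i m * s k m j)) => p.
by rewrite !E (mulrC (x p k)).
Qed.

(** Both sides are the sum over the points of w x_k x_i x_j. *)
Lemma forced_polar k i j : (i < 5)%N -> (j < 5)%N ->
  \sum_(0 <= m < 5) s k i m * polar R m j = \sum_(0 <= m < 5) s k j m * polar R m i.
Proof.
have E i' j' : (j' < 5)%N ->  \sum_(0 <= m < 5) s k i' m * polar R m j' =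
    \sum_p w p * (x p k * x p i' * x p j').
  move=> j5; rewrite (eq_big_nat _ _ (F2 := fun m => \sum_p s k i' m * (w p * x p m * x p j'))).
    rewrite exchange_big; apply: eq_bigr => p _ /=.
    rewrite -forced_mul mulr_suml mulr_sumr; apply: eq_bigr => m _; ring.
  by move=> m /andP[_ m5]; rewrite -polarE // mulr_sumr.
by move=> i5 j5; rewrite !E //; apply: eq_bigr => p _; ring.
Qed.

Lemma forced_unit k j : (k < 5)%N -> (j < 5)%N -> s k 0 j = (k == j)%:R.
Proof.
move=> k5; apply: (forced_uniq (u := s k 0) (v := fun j => (k == j)%:R)) => m.
rewrite forced_mul x0 mulr1 big_mkord (bigD1 (Ordinal k5)) //= eqxx mul1r.
rewrite big1 ?addr0 // => j' j'k; rewrite (_ : (k == j') = false) ?mul0r //.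
by apply: contraNF j'k => /eqP kj; apply/eqP/val_inj.
Qed.

(** The zeros stand for d and e, which do not occur in products of y_2, y_3, y_4. *)
Lemma forced_table k i j : (0 < k < 4)%N -> (0 < i < 4)%N -> (j < 5)%N ->
  s k i j = sc_gen A c (fun=> 0) 0 k i j.
Proof.
move=> k4 i4; apply: (forced_uniq (u := s k i) (v := sc_gen A c (fun=> 0) 0 k i)) => m.
rewrite forced_mul mulE // sum_0_5 sum_1_4 x0 mulr1 addrC.
case: k k4 => [//|[|[|[|//]]]] _; case: i i4 => [//|[|[|[|//]]]] _ /=.
all: ring.
Qed.

Let d k := s 4 4 k.
Let e := s 4 4 0.

(** Products with y_5 are read off from the invariance of the polar form: pairing with 1 gives the
    coefficient of y_5, pairing with y_j twice that of y_j, pairing with y_5 the constant term. *)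
Lemma forced_sc_gen k i j : (k < 5)%N -> (i < 5)%N -> (j < 5)%N ->
  s k i j = sc_gen A c d e k i j.
Proof.
have s44 k' : (0 < k' < 5)%N -> s k' 4 4 = 0.
  move=> /andP[k0 k5]; have := @forced_polar k' 4 0 isT isT.
  rewrite !sum_0_5 /= !mulr0 !add0r !addr0 !mulr1 => ->.
  by rewrite forced_unit // (gtn_eqF k0).
have s4 k' j' : (0 < j' < 4)%N -> s k' 4 j' *+ 2 = s k' j' 0.
  case/andP=> j0 j4; have := @forced_polar k' 4 j' isT (ltnW j4).
  by rewrite !sum_0_5; case: j' j0 j4 => [|[|[|[|//]]]] //= _ _ ?; lra.
have s2I (u v : R) : u *+ 2 = v *+ 2 -> u = v by lra.
have s4c k' j' : (0 < k' < 4)%N -> (0 < j' < 4)%N -> s k' 4 j' = c k' j'.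
  by move=> k4 j4; apply: s2I; rewrite s4 // forced_table //; move: k4 j4;
     case: k' j' => [|[|[|[|//]]]] [|[|[|[|//]]]].
have s40 k' : (0 < k' < 4)%N -> s k' 4 0 = d k' *+ 2 by move=> k4; rewrite /d s4 // forcedC.
have [-> _ i5 j5|k0] := posnP k; first by rewrite forcedC forced_unit.
have [-> k5 _ j5|i0] := posnP i.
  by rewrite forced_unit //; move: k0 k5; case: (k) => [|[|[|[|[|]]]]].
move=> k5 i5 j5; have [k4|k4] := ltnP k 4; have [i4|i4] := ltnP i 4.
- rewrite forced_table ?k0 ?i0 //.
  by case: k k0 k4 {k5} => [|[|[|[|]]]] // _ _; case: i i0 i4 {i5} => [|[|[|[|]]]].
- have -> : i = 4%N by apply/eqP; rewrite eqn_leq i4 andbT.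
  case: j j5 => [|j] j5; first by rewrite s40 ?k0 //; case: k k0 k4 {k5} => [|[|[|[|]]]].
  have [j3|j3] := ltnP j 3.
    by rewrite s4c ?k0 //; case: k k0 k4 {k5} => [|[|[|[|]]]] // _ _; case: j j3 {j5} => [|[|[|]]].
  have -> : j = 3%N by apply/eqP; rewrite eqn_leq j3 andbT.
  by rewrite s44 ?k0 //; case: k k0 k4 {k5} => [|[|[|[|]]]].
- have -> : k = 4%N by apply/eqP; rewrite eqn_leq k4 andbT.
  rewrite forcedC; case: j j5 => [|j] j5; first by rewrite s40 ?i0 //; case: i i0 i4 {i5} => [|[|[|[|]]]].
  have [j3|j3] := ltnP j 3.
    by rewrite s4c ?i0 //; case: i i0 i4 {i5} => [|[|[|[|]]]] // _ _; case: j j3 {j5} => [|[|[|]]].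
  have -> : j = 3%N by apply/eqP; rewrite eqn_leq j3 andbT.
  by rewrite s44 ?i0 //; case: i i0 i4 {i5} => [|[|[|[|]]]].
- have -> : k = 4%N by apply/eqP; rewrite eqn_leq k4 andbT.
  have -> : i = 4%N by apply/eqP; rewrite eqn_leq i4 andbT.
  by case: j j5 => [|[|[|[|[|]]]]] // _; rewrite s44.
Qed.

Lemma forced_assoc_gen k l i j : (k < 5)%N -> (l < 5)%N -> (i < 5)%N -> (j < 5)%N ->
  \sum_(0 <= m < 5) sc_gen A c d e k i m * sc_gen A c d e l m j =
  \sum_(0 <= m < 5) sc_gen A c d e l i m * sc_gen A c d e k m j.
Proof.
move=> k5 l5 i5 j5; have := @forced_assoc k l i j j5.
by rewrite !sum_0_5 !forced_sc_gen.
Qed.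

Let cC i j : (0 < i < 4)%N -> (0 < j < 4)%N -> c i j = c j i.
Proof.
move=> i4 j4; have := forcedC i j 0; rewrite !forced_table //.
by case: i j i4 j4 => [|[|[|[|//]]]] [|[|[|[|//]]]] //= _ _; lra.
Qed.

Lemma forced_c i j : (0 < i < 4)%N -> (0 < j < 4)%N -> c i j = sc_c A i j.
Proof.
have aC := symmetric3_sort symA; have scC := sc_cC symA.
have c21 := @cC 2 1 isT isT; have c31 := @cC 3 1 isT isT; have c32 := @cC 3 2 isT isT.
have E k l i' j' := @forced_assoc_gen k l i' j'.
(* [E1], [E2], [E3] give the pairwise sums of the diagonal entries of c; [E4], [E5], [E6] give the
   off-diagonal entries (2,3), (1,3), (1,2). *)
have E1 := E 1%N 2%N 1%N 2%N isT isT isT isT; have E2 := E 1%N 3%N 1%N 3%N isT isT isT isT.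
have E3 := E 2%N 3%N 2%N 3%N isT isT isT isT; have E4 := E 1%N 2%N 1%N 3%N isT isT isT isT.
have E5 := E 2%N 1%N 2%N 3%N isT isT isT isT; have E6 := E 3%N 1%N 3%N 2%N isT isT isT isT.
rewrite !sum_0_5 /= ?c21 ?c31 ?c32 ?aC in E1 E2 E3 E4 E5 E6.
case: i j => [|[|[|[|//]]]] [|[|[|[|//]]]] //= _ _.
all: rewrite ?c21 ?c31 ?c32 ?scC (sc_cE symA).
all: lra.
Qed.

Lemma forced_d i : (0 < i < 4)%N -> d i = sc_d A i.
Proof.
have aC := symmetric3_sort symA; have scC := sc_cC symA.
have E k l i' j' := @forced_assoc_gen k l i' j'.
(* Each d_i is determined by two of the six equations, and [sc_d] is the mean of the two
   expressions. *)
have E1 := E 1%N 2%N 1%N 0%N isT isT isT isT; have E2 := E 1%N 3%N 1%N 0%N isT isT isT isT.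
have E3 := E 2%N 3%N 2%N 0%N isT isT isT isT; have E4 := E 2%N 1%N 2%N 0%N isT isT isT isT.
have E5 := E 3%N 1%N 3%N 0%N isT isT isT isT; have E6 := E 3%N 2%N 3%N 0%N isT isT isT isT.
rewrite !sum_0_5 /= !forced_c // ?scC ?aC in E1 E2 E3 E4 E5 E6.
rewrite /sc_d !sum_1_4.
by case: i => [|[|[|[|//]]]] //= _; rewrite ?scC ?aC; lra.
Qed.

Lemma forced_e : e = sc_e A.
Proof.
have := @forced_assoc_gen 4 1 1 0 isT isT isT isT.
rewrite !sum_0_5 /= !forced_c // !forced_d // /sc_e sum_1_4 ?(sc_cC symA) => E1.
lra.
Qed.

Lemma forced_sc k i j : (k < 5)%N -> (i < 5)%N -> (j < 5)%N -> s k i j = sc A k i j.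
Proof.
move=> k5 i5 j5; rewrite forced_sc_gen //.
case: k k5 => [|[|[|[|[|//]]]]] _; case: i i5 => [|[|[|[|[|//]]]]] _.
all: case: j j5 => [|[|[|[|[|//]]]]] _.
all: by rewrite /sc /= ?forced_c ?forced_d ?forced_e.
Qed.

(** In the basis of idempotents, multiplication by a coordinate is diagonal with the values at the
    points as entries, so the trace of a product is a sum over the points. *)
Lemma trace_form_forced : trace_form A = X^T *m X.
Proof.
have trE l : (l < 5)%N -> sc_tr A l = \sum_m x m l.
  move=> l5; pose D := diag_mx (\row_m x m l).
  have XtU : X^T \in unitmx by rewrite unitmx_tr.
  transitivity (\tr (X^T *m D *m invmx X^T)).
    rewrite /mxtrace /sc_tr big_mkord; apply: eq_bigr => i _.
    rewrite -forced_sc // mul_mx_diag mxE; apply: eq_bigr => m _.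
    by rewrite !mxE inord_val [x m l * _]mulrC.
  rewrite mxtrace_mulC mulmxA mulVmx // mul1mx mxtrace_diag.
  by apply: eq_bigr => m _; rewrite mxE.
apply/matrixP => j k; rewrite !mxE /trace_entry.
under eq_big_nat => l /andP[_ l5] do rewrite trE // -forced_sc // mulr_sumr.
rewrite exchange_big; apply: eq_bigr => m _ /=.
by rewrite forced_mul !mxE.
Qed.
End Forced.

Lemma scaled_relation_inv (K : fieldType) (t x y b z s c : K) : t != 0 ->
  t * x * (t * y) - b * (t * (t * z)) - t * t * s - c * t ^+ 2 = 0 ->
  x * y - b * z - s = c.
Proof.
move=> t0 E; apply: (mulfI t0); apply: (mulfI t0); apply/eqP.
by rewrite -subr_eq0 -[X in _ == X]E; apply/eqP; ring.
Qed.

Lemma inord0E n : inord 0 = 0 :> 'I_n.+1.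
Proof. by apply/val_inj; rewrite /= inordK. Qed.

(** * Real decompositions give Gram matrices *)

Section Gram.
Context (R : realType).
Local Notation C := R[i].
Local Notation toC := (map_mx (real_complex R)).

Lemma meval_linear_form (v : 'I_5 -> C) (u : 'rV[C]_5) :
  meval v (linear_form u) = \sum_(j < 5) u 0 j * v j.
Proof. by rewrite rmorph_sum; apply: eq_bigr => j _; rewrite /= mevalZ mevalXU. Qed.

Lemma meval_quadric (v : 'I_5 -> C) :
  meval v (quadric R) =
    v (inord 0) * v (inord 4) + v (inord 1) ^+ 2 + v (inord 2) ^+ 2 + v (inord 3) ^+ 2.
Proof. by rewrite /quadric !rmorphD rmorphM !rmorphXn /= !meval_var. Qed.

Lemma quadric_polar (lam : 'I_5 -> C) (u : 'I_5 -> 'rV[C]_5) :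
  quadric R = \sum_(i < 5) lam i *: linear_form (u i) ^+ 2 ->
  forall j k : 'I_5, \sum_i lam i *+ 2 * u i 0 j * u i 0 k = polar C j k.
Proof.
move=> E j k; pose q v := meval v (quadric R).
pose e (j m : 'I_5) : C := (m == j)%:R.
have qE v : q v = \sum_i lam i * (\sum_(m < 5) u i 0 m * v m) ^+ 2.
  rewrite /q E rmorph_sum; apply: eq_bigr => i _.
  by rewrite /= mevalZ rmorphXn /= meval_linear_form.
have ue i (l : 'I_5) : \sum_(m < 5) u i 0 m * e l m = u i 0 l.
  rewrite (bigD1 l) //= /e eqxx mulr1 big1 ?addr0 // => m /negbTE ->.
  by rewrite mulr0.
(* Polarisation on unit vectors, which explains why the polar matrix is twice the Gram matrix. *)
transitivity (q (fun m => e j m + e k m) - q (e j) - q (e k)).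
  rewrite !qE -!sumrB; apply: eq_bigr => i _; rewrite !ue.
  under [X in _ = _ * X ^+ 2 - _ - _]eq_bigr do rewrite mulrDr.
  by rewrite big_split /= !ue; ring.
have eE (l : 'I_5) m : (m < 5)%N -> e l (inord m) = (m == l :> nat)%:R.
  by move=> m5; rewrite /e -val_eqE /= inordK.
rewrite /q !meval_quadric !eE //.
case: j k => [[|[|[|[|[|//]]]]] ?] [[|[|[|[|[|//]]]]] ?] /=; ring.
Qed.

Lemma polar_mx_unit (K : numFieldType) : polar_mx K \in unitmx.
Proof.
rewrite -row_free_unit; apply/row_freeP.
(* The matrix is symmetric with one nonzero entry in each row, so its inverse is entrywise, with
   0^-1 = 0. *)
exists (\matrix_(j, k) (polar K j k)^-1).
apply/matrixP => j k; rewrite !mxE sum_inord5.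
rewrite (eq_big_nat _ _ (F2 := fun m => polar K j m / polar K m k)) => [|m /andP[_ m5]].
  rewrite sum_0_5 -val_eqE.
  have two0 : 2 != 0 :> K by rewrite pnatr_eq0.
  case: j k => [[|[|[|[|[|//]]]]] ?] [[|[|[|[|[|//]]]]] ?] /=;
    by rewrite ?(mulr0, mul0r, add0r, addr0, invr0, invr1, mulr1) ?mulfV.
by rewrite !mxE inordK.
Qed.

(** Disjointness from y_1 = 0 allows the points to be scaled to first coordinate 1, and
    nondegeneracy of the quadric makes them independent; then the forced structure constants
    apply. *)
Lemma SSP_patch_gram (a : 'rV[R]_10) : SSP_patch (quadric R) a ->
  exists2 X : 'M[R]_5, X \in unitmx & trace_form (tensor a) = X^T *m X.
Proof.
move=> [I [[VI [l [lam [l0 fE IE]]]] [_ dI] coordI]].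
have lI i g : I g -> meval (complexify (l i) 0) g = 0.
  rewrite IE => /(_ i 1) <-; congr (meval _ _); apply/funext => j.
  by rewrite mul1r.
have l1 i : l i 0 0 != 0.
  have := dI (complexify (l i)); rewrite meval_var mxE.
  rewrite (_ : inord 0 = 0); last by apply/val_inj; rewrite /= inordK.
  rewrite fmorph_eq0; apply; last exact: lI.
  apply: contraNneq (l0 i) => /rowP li0; apply/eqP/rowP => j.
  by have := li0 j; rewrite !mxE => /eqP; rewrite fmorph_eq0 => /eqP.
pose x i (j : nat) := l i 0 (inord j) / l i 0 0.
pose X := \matrix_(m, j < 5) x m j.
pose mu i : C := lam i *+ 2 * (l i 0 0)%:C%C ^+ 2.
have polarC (j k : 'I_5) : \sum_i mu i * (x i j)%:C%C * (x i k)%:C%C = polar C j k.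
  rewrite -(quadric_polar fE); apply: eq_bigr => i _.
  rewrite /mu /x !inord_val !mxE !rmorphM !fmorphV /=.
  have : (l i 0 0)%:C%C != 0 :> C by rewrite fmorph_eq0.
  by move: (_%:C%C) => z z0; field.
have Xu : X \in unitmx.
  suff : toC X \in unitmx by rewrite map_unitmx.
  have E : (toC X)^T *m diag_mx (\row_i mu i) *m toC X = polar_mx C.
    apply/matrixP => j k; rewrite !mxE -polarC; apply: eq_bigr => i _.
    by rewrite mul_mx_diag !mxE [_ * mu i]mulrC.
  by have := polar_mx_unit C; rewrite -E unitmx_mul => /andP[_].
(* The coefficients are only known to be complex, but points and polar form are real, so the real
   parts satisfy the same equations. *)
pose w i := complex.Re (mu i).
have polarE j k : (j < 5)%N -> (k < 5)%N -> \sum_i w i * x i j * x i k = polar R j k.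
  move=> j5 k5; have /(congr1 (@complex.Re R)) := polarC (Ordinal j5) (Ordinal k5).
  rewrite (raddf_sum (@complex.Re R : Rcomplex R -> R)) /= => E.
  transitivity (complex.Re (polar C j k)); last first.
    by case: j k {j5 k5 E} => [|[|[|[|[|j]]]]] [|[|[|[|[|k]]]]].
  rewrite -E; apply: eq_bigr => i _; rewrite /w; case: (mu i) => p q /=.
  by rewrite !mulr0 !subr0.
(* The constant term c_ij as computed at the k-th point; one quadric of the ideal serves all points,
   so it does not depend on k. *)
pose G k i j := x k i * x k j - (i == j)%:R *+ 2 * x k 4%N
  - \sum_(1 <= m < 4) tensor a i j m *+ 4 * x k m.
have GE k i j : (0 < i < 4)%N -> (0 < j < 4)%N -> G k i j = G 0 i j.
  wlog: i j / (i <= j)%N.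
    move=> hw i4 j4; have [ij|/ltnW ij] := leqP i j; first exact: hw.
    have GC k' : G k' i j = G k' j i.
      rewrite /G (mulrC (x k' i)) (eq_sym i); congr (_ - _); apply: eq_bigr => m _.
      by rewrite (symmetric3_tensor _ _ _ _).1.
    by rewrite !GC hw.
  move=> ij /andP[i0 i4] /andP[j0 j4].
  have [c Ic] := coordI i.+1 j.+1 i0 ij j4.
  have GC k' : (G k' i j)%:C%C = c.
    pose z : C := (l k' 0 0)%:C%C.
    have z0 : z != 0 by rewrite fmorph_eq0.
    have vE m : complexify (l k') 0 (inord m) = z * (x k' m)%:C%C.
      by rewrite mxE /x rmorphM fmorphV mulrC mulfVK.
    have v0 : complexify (l k') 0 0 = z by rewrite mxE.
    have := lI k' _ Ic; rewrite meval_patch_quadric /= !vE v0.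
    rewrite (eq_big_nat _ _ (F2 := fun m =>
      z * z * (tensor a i j m *+ 4 * x k' m)%:C%C)) => [|m _]; last first.
      by rewrite vE tensorMn4 (rmorphM _ (a 0 _)) /= [complexify a _ _]mxE; ring.
    rewrite -mulr_sumr -rmorph_sum => /(scaled_relation_inv z0) <-.
    rewrite /G !rmorphB !rmorphM /= eqSS; congr (_ - _ * _ - _).
    by case: eqP => _; rewrite ?mul0rn ?rmorph0 // rmorph_nat.
  by apply: (@complexI R); rewrite !GC.
exists X => //; apply: (@trace_form_forced _ _ x w (fun i j => G 0 i j / 2)) => //.
- exact: symmetric3_tensor.
- by move=> m; rewrite /x inord0E divff.
- move=> m i j i4 j4; rewrite -(GE m) // [_ / 2 *+ 2]mulr2n -splitr /G.
  ring.
Qed.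
End Gram.

(** * The boundary lies in the zero locus of the discriminant *)

Local Open Scope classical_set_scope.

Section Topology.
Context (R : realType).

Lemma meval_continuous n (P : mpoly n R) : continuous (fun a : 'rV[R]_n => meval (a 0) P).
Proof.
have contM (f g : 'rV[R]_n -> R) : continuous f -> continuous g ->
    continuous (fun a => f a * g a) by move=> cf cg a; exact: (cvgM (cf a) (cg a)).
have prod_cont (m : multinom n) (s : seq 'I_n) :
    continuous (fun a : 'rV[R]_n => \prod_(i <- s) a 0 i ^+ m i).
  elim: s => [|i s IHs]; first by under eq_fun do rewrite big_nil; exact: cst_continuous.
  under eq_fun do rewrite big_cons; apply: (contM _ _ _ IHs).
  elim: (m i) => [|k IHk]; first by under eq_fun do rewrite expr0; exact: cst_continuous.
  under eq_fun do rewrite exprS; apply: (contM _ _ _ IHk).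
  exact: coord_continuous.
have sum_cont (s : seq (multinom n)) : continuous (fun a : 'rV[R]_n =>
    \sum_(m <- s) mcoeff m P * \prod_(i < n) a 0 i ^+ m i).
  elim: s => [|m s IHs]; first by under eq_fun do rewrite big_nil; exact: cst_continuous.
  under eq_fun do rewrite big_cons.
  move=> a.
  by apply: (cvgD _ (IHs a)); apply: (contM _ _ _ (prod_cont _ _)); exact: cst_continuous.
by under eq_fun do rewrite mevalE; exact: sum_cont.
Qed.

Local Notation T a := (trace_form (tensor a)).
Local Notation F := (quadric R).

Definition generic_tensor (K : fieldType) (i j k : nat) : mpoly 10 K :=
  mpolyC 10 4^-1 * mpolyX K (mnm1 (coord_index i.+1 j.+1 k.+1)).

Lemma meval_tensor (K : fieldType) (a : 'rV[K]_10) i j k :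
  meval (a 0) (generic_tensor K i j k) = tensor a i j k.
Proof. by rewrite rmorphM /= mevalC mevalXU. Qed.

Lemma meval_trace_form (K : fieldType) (a : 'rV[K]_10) :
  map_mx (meval (a 0)) (trace_form (generic_tensor K)) = trace_form (tensor a).
Proof.
apply/matrixP => i j; rewrite !mxE trace_entry_morph.
by congr trace_entry; do 3![apply/funext => ?]; exact: meval_tensor.
Qed.

Lemma posdef_gram (X : 'M[R]_5) : X \in unitmx -> posdef (X^T *m X).
Proof.
move=> Xu y y0; rewrite mulmxA -mulmxA.
set z := y *m X^T; have z0 : z != 0.
  apply: contraNneq y0 => zE; have XtU : X^T \in unitmx by rewrite unitmx_tr.
  by rewrite -(mulmxK XtU y) -/z zE mul0mx.
rewrite (_ : X *m y^T = z^T); last by rewrite trmx_mul trmxK.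
clearbody z.
have [j zj] : exists j, z 0 j != 0.
  apply/existsP; apply: contraR z0; rewrite negb_exists => /forallP z0.
  by apply/eqP/rowP => j; have := z0 j; rewrite negbK => /eqP ->; rewrite mxE.
rewrite mxE (bigD1 j) //= !mxE; apply: ltr_wpDr; last by rewrite -expr2 exprn_even_gt0 //=.
by apply: sumr_ge0 => m _; rewrite mxE -expr2 sqr_ge0.
Qed.

Lemma SSP_patchP (a : 'rV[R]_10) : SSP_patch F a <-> posdef (T a).
Proof.
split; last exact: SSP_patch_posdef.
by move=> /SSP_patch_gram[X Xu ->]; apply: posdef_gram.
Qed.

(** By 2 |z_i z_j| <= z_i^2 + z_j^2 the perturbation is at most 10 / 20 times the sum of the z_i^2,
    half of the main term. *)
Lemma posdef_near1 (E : 'M[R]_5) : (forall i j, `|E i j| < 10^-1) -> posdef (1%:M + E).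
Proof.
move=> small z z0; have zz : 0 < \sum_i z 0 i ^+ 2.
  have [j zj] : exists j, z 0 j != 0.
    apply/existsP; apply: contraR z0; rewrite negb_exists => /forallP z0.
    by apply/eqP/rowP => j; have := z0 j; rewrite negbK => /eqP ->; rewrite mxE.
  rewrite (bigD1 j) //=; apply: ltr_wpDr; last by rewrite exprn_even_gt0 //= zj.
  by apply: sumr_ge0 => m _; rewrite sqr_ge0.
have -> : (z *m (1%:M + E) *m z^T) 0 0 =
    \sum_i z 0 i ^+ 2 + \sum_j \sum_i z 0 i * E i j * z 0 j.
  rewrite mulmxDr mulmx1 mulmxDl mxE; congr (_ + _); rewrite mxE; apply: eq_bigr => j _.
    by rewrite mxE -expr2.
  by rewrite !mxE mulr_suml.
have : 0 <= \sum_j \sum_i (z 0 i * E i j * z 0 j + (z 0 i ^+ 2 + z 0 j ^+ 2) / 20).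
  apply: sumr_ge0 => j _; apply: sumr_ge0 => i _.
  have := small i j; rewrite ltr_norml => /andP[lo hi].
  have -> : z 0 i * E i j * z 0 j + (z 0 i ^+ 2 + z 0 j ^+ 2) / 20 =
    ((10^-1 + E i j) * (z 0 i + z 0 j) ^+ 2 + (10^-1 - E i j) * (z 0 i - z 0 j) ^+ 2) / 4.
    by field.
  by rewrite divr_ge0 // addr_ge0 // mulr_ge0 ?sqr_ge0 //; lra.
have -> : \sum_j \sum_i (z 0 i * E i j * z 0 j + (z 0 i ^+ 2 + z 0 j ^+ 2) / 20) =
    \sum_j \sum_i z 0 i * E i j * z 0 j + (\sum_i z 0 i ^+ 2) / 2.
  rewrite (eq_bigr (fun j => \sum_i z 0 i * E i j * z 0 j +
      (\sum_i z 0 i ^+ 2 + z 0 j ^+ 2 *+ 5) / 20)) => [|j _].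
    rewrite big_split /= -[X in _ + X = _]mulr_suml big_split /= sumr_const card_ord sumrMnl.
    by congr (_ + _); field.
  by rewrite big_split /= -[X in _ + X = _]mulr_suml big_split /= sumr_const card_ord.
move=> H; lra.
Qed.

(** Congruence by X turns the trace form at b into 1 + E(b), with E continuous and zero at a. *)
Lemma SSP_patch_open (a : 'rV[R]_10) : SSP_patch F a -> nbhs a (SSP_patch F).
Proof.
move=> /SSP_patch_gram[X Xu Ta].
have XtU : X^T \in unitmx by rewrite unitmx_tr.
pose E (b : 'rV[R]_10) := invmx X^T *m (T b - T a) *m invmx X.
have TE b : T b = X^T *m (1%:M + E b) *m X.
  by rewrite mulmxDr mulmxDl mulmx1 -Ta /E !mulmxA mulmxV // mul1mx mulmxKV // addrC subrK.
have Ea : E a = 0 by rewrite /E subrr mulmx0 mul0mx.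
have Econt i j : continuous (fun b => E b i j).
  pose c (M : 'M[R]_5) := map_mx (@mpolyC 10 R) M.
  pose EP : 'M_5 := c (invmx X^T) *m (trace_form (generic_tensor R) - c (T a)) *m c (invmx X).
  have cK (b : 'rV[R]_10) (M : 'M[R]_5) : map_mx (meval (b 0)) (c M) = M.
    by apply/matrixP => p q; rewrite !mxE mevalC.
  suff -> : (fun b => E b i j) = (fun b => meval (b 0) (EP i j)) by apply: meval_continuous.
  apply/funext => b; transitivity (map_mx (meval (b 0)) EP i j); last by rewrite mxE.
  by rewrite !map_mxM map_mxB !cK meval_trace_form.
have small : \forall b \near a, forall i j, `|E b i j| < 10^-1.
  apply: (@filter_forall _ _ (fun i b => forall j, `|E b i j| < 10^-1) (nbhs a) _) => i.
  apply: (@filter_forall _ _ (fun j b => `|E b i j| < 10^-1) (nbhs a) _) => j.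
  have Eaij : E a i j = 0 by rewrite Ea mxE.
  have := Econt i j a; rewrite /continuous_at Eaij => /cvgr0Pnorm_lt; apply.
  by rewrite invr_gt0.
apply: filterS small => b small; apply/SSP_patchP => y y0.
rewrite TE !mulmxA -mulmxA (_ : X *m y^T = (y *m X^T)^T); last by rewrite trmx_mul trmxK.
apply: posdef_near1 => //; apply: contraNneq y0 => zE.
by rewrite -(mulmxK XtU y) zE mul0mx.
Qed.

Lemma closure_SSP_patch_ge0 (a : 'rV[R]_10) (y : 'rV[R]_5) :
  closure (SSP_patch F) a -> 0 <= (y *m T a *m y^T) 0 0.
Proof.
move=> cla; rewrite leNgt; apply/negP => neg.
pose c m n (M : 'M[R]_(m, n)) := map_mx (@mpolyC 10 R) M.
have cK m n (b : 'rV[R]_10) (M : 'M[R]_(m, n)) : map_mx (meval (b 0)) (c _ _ M) = M.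
  by apply/matrixP => p q; rewrite !mxE mevalC.
pose QP := (c _ _ y *m trace_form (generic_tensor R) *m c _ _ (y^T)) 0 0.
have QE b : (y *m T b *m y^T) 0 0 = meval (b 0) QP.
  transitivity (map_mx (meval (b 0)) (c _ _ y *m trace_form (generic_tensor R) *m c _ _ (y^T)) 0 0).
    by rewrite !map_mxM !cK meval_trace_form.
  by rewrite mxE.
have negn : nbhs a [set b | meval (b 0) QP < 0].
  by have := @meval_continuous 10 QP a; rewrite /continuous_at => /cvgr_lt; apply; rewrite -QE.
have [b [/SSP_patchP posb]] := cla _ negn; rewrite /= -QE.
have [->|y0] := eqVneq y 0; first by rewrite !mul0mx mxE ltxx.
by move=> lt0; have := lt_trans lt0 (posb _ y0); rewrite ltxx.
Qed.

(** On the closure the trace form is semidefinite, and an isotropic vector of a semidefinite form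
    lies in its radical. *)
Lemma closure_SSP_patch_disc (a : 'rV[R]_10) :
  closure (SSP_patch F) a -> disc (tensor a) != 0 -> SSP_patch F a.
Proof.
move=> cla d0; apply/SSP_patchP => y y0; rewrite lt_def closure_SSP_patch_ge0 // andbT.
apply: contraNneq y0 => yTy.
have Tu : T a \in unitmx by rewrite unitmxE unitfE.
have yT0 : y *m T a = 0.
  apply/rowP => j; rewrite [RHS]mxE.
  pose u : 'rV[R]_5 := delta_mx 0 j; pose p := (y *m T a *m u^T) 0 0.
  have -> : (y *m T a) 0 j = p by rewrite /p /u trmx_delta -colE [RHS]mxE.
  pose q := (u *m T a *m u^T) 0 0.
  have pq t : 0 <= t * p *+ 2 + t ^+ 2 * q.
    have := closure_SSP_patch_ge0 (y + t *: u) cla.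
    rewrite linearD linearZ /= !mulmxDl !mulmxDr -!scalemxAl -!scalemxAr scalerA.
    have -> : u *m T a *m y^T = y *m T a *m u^T.
      have -> : u *m T a *m y^T = (u *m T a *m y^T)^T.
        by rewrite [u *m T a *m y^T]mx11_scalar tr_scalar_mx.
      by rewrite !trmx_mul trmxK trace_form_sym ?mulmxA //; exact: symmetric3_tensor.
    have E4 (A B C D : 'M[R]_1) : (A + t *: B + (t *: C + (t * t) *: D)) 0 0 =
      A 0 0 + t * B 0 0 + (t * C 0 0 + t * t * D 0 0) by rewrite !mxE.
    rewrite E4 yTy -/p -/q => H; apply: le_trans H _.
    by rewrite le_eqVlt; apply/orP; left; apply/eqP; ring.
  have q0 : 0 <= q by exact: closure_SSP_patch_ge0.
  apply/eqP; apply: contraT => p0.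
  (* Dividing by q + 1 instead of q avoids a separate case q = 0. *)
  have := pq (- p / (q + 1)).
  have q1 : q + 1 != 0 by lra.
  have -> : - p / (q + 1) * p *+ 2 + (- p / (q + 1)) ^+ 2 * q =
    - (p ^+ 2 * (q + 2) / (q + 1) ^+ 2) by field.
  have pp : 0 < p ^+ 2 by rewrite exprn_even_gt0.
  have qq : 0 < (q + 1) ^+ 2 by rewrite exprn_even_gt0.
  by rewrite oppr_ge0 leNgt divr_gt0 // mulr_gt0 //; lra.
by rewrite -(mulmxK Tu y) yT0 mul0mx.
Qed.

Lemma boundary_disc (a : 'rV[R]_10) :
  (closure (SSP_patch F) `\` (closure (SSP_patch F))°) a -> disc (tensor a) = 0.
Proof.
move=> [cla nint]; apply/eqP; apply: contraPT nint => d0; apply.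
by apply: filterS (SSP_patch_open (closure_SSP_patch_disc cla d0)); exact: subset_closure.
Qed.

Lemma closure_SSP_patch_disc_ge0 (a : 'rV[R]_10) :
  closure (SSP_patch F) a -> 0 <= disc (tensor a).
Proof.
move=> cla; have [->//|/(closure_SSP_patch_disc cla)/SSP_patch_gram[X Xu E]] := eqVneq (disc (tensor a)) 0.
by rewrite /disc E det_mulmx det_tr -expr2 sqr_ge0.
Qed.

(** If the line missed the boundary, its part inside the closure would be open, closed and nonempty,
    hence the whole line, although the discriminant is nonnegative on the closure. *)
Lemma boundary_crossing (a v : 'rV[R]_10) (t : R) :
  SSP_patch F a -> disc (tensor (a + t *: v)) < 0 ->
  exists u : R, (closure (SSP_patch F) `\` (closure (SSP_patch F))°) (a + u *: v).
Proof.
move=> Sa neg; apply: contrapT => no.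
pose g (u : R) : 'rV[R]_10 := a + u *: v.
have gc : continuous g.
  by move=> u; apply: cvgD; [exact: cvg_cst | exact: scalel_continuous].
pose B := g @^-1` closure (SSP_patch F).
have BE : B = g @^-1` (closure (SSP_patch F))°.
  apply/seteqP; split=> u Bu; last exact: interior_subset Bu.
  by apply: contrapT => nB; apply: no; exists u.
have conn : connected [set: R] by apply/connected_intervalP.
have BT : B = [set: R].
  apply: conn.
  - by exists 0; rewrite /B /= /g scale0r addr0; apply: subset_closure.
  - exists B; last by rewrite setTI.
    rewrite BE; apply: open_comp; last exact: open_interior.
    by move=> u _; exact: gc.
  - exists B; last by rewrite setTI.
    by move/continuous_closedP: gc; apply; exact: closed_closure.
have : B t by rewrite BT.
by move=> /closure_SSP_patch_disc_ge0; rewrite leNgt neg.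
Qed.
End Topology.

(** * Irreducibility of polynomials in two variables *)

Lemma scale_polyI (B : idomainType) (a : B) (p q : {poly B}) :
  a != 0 -> a *: p = a *: q -> p = q.
Proof. by move=> a0; rewrite -!mul_polyC => /mulfI; apply; rewrite polyC_eq0. Qed.

Section Strip.
Context (A : idomainType).
Implicit Types (c : {poly A}) (F D Q : {poly {poly A}}).
Local Notation ev r := (map_poly (horner_eval r)).

Lemma poly_factor_coef D (r : A) : ev r D = 0 -> exists D', D = ('X - r%:P) *: D'.
Proof.
elim/poly_ind: D => [|D c IHD]; first by exists 0; rewrite scaler0.
rewrite rmorphD rmorphM /= map_polyX map_polyC /= => E.
have [cr Dr] : c.[r] = 0 /\ ev r D = 0.
  have c0 : c.[r] = 0.
    by have /polyP/(_ 0%N) := E; rewrite coefD coefMX coefC add0r coef0.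
  split=> //; move: E; rewrite /horner_eval c0 addr0 => /eqP.
  by rewrite mulf_eq0 polyX_eq0 orbF => /eqP.
have [D' ->] := IHD Dr; have /factor_theorem[c' ->] : root c r by apply/eqP.
exists (D' * 'X + c'%:P); rewrite scalerDr -scalerAl; congr (_ + _).
by rewrite -mul_polyC -polyCM mulrC.
Qed.

(* Gauss's lemma for the prime X - r. *)
Lemma strip_root (r : A) c F D Q : c != 0 -> c *: F = D * Q ->
  exists c' D' Q', [/\ c'.[r] != 0, c' *: F = D' * Q',
    size D' = size D, size Q' = size Q &
    (size c' + (c.[r] == 0)%R <= size c)%N].
Proof.
have [n] := ubnP (size c); elim: n c D Q => // n IHn c D Q cn c0 E.
have [cr|cr] := eqVneq c.[r] 0; last by exists c, D, Q; split=> //; rewrite addn0.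
have /factor_theorem[c1 cE] : root c r by apply/eqP.
have xr0 : 'X - r%:P != 0 by rewrite polyXsubC_eq0.
have c10 : c1 != 0 by apply: contraNneq c0 => c10; rewrite cE c10 mul0r.
have sc : size c = (size c1).+1.
  by rewrite cE size_Mmonic ?monicXsubC // size_XsubC addn2.
have cn1 : (size c1 < n)%N by rewrite -ltnS -sc.
have step D1 Q1 : ev r D1 = 0 -> c *: F = D1 * Q1 ->
    exists c' D' Q', [/\ c'.[r] != 0, c' *: F = D' * Q', size D' = size D1,
      size Q' = size Q1 & (size c' < size c)%N].
  move=> /poly_factor_coef [P' PE] E1.
  have [|c' [D' [Q' [H1 H2 H3 H4 H5]]]] := IHn c1 P' Q1 cn1 c10.
    by apply: (scale_polyI xr0); rewrite scalerA mulrC -cE E1 PE -scalerAl.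
  exists c', D', Q'; split=> //; first by rewrite H3 PE size_scale.
  by rewrite sc ltnS (leq_trans _ H5) // leq_addr.
have : ev r D * ev r Q = 0.
  by rewrite -rmorphM -E /= map_polyZ /= /horner_eval cr scale0r.
move=> /eqP; rewrite mulf_eq0 => /orP[] /eqP /step st.
  by have [c' [D' [Q' [H1 H2 H3 H4 H5]]]] := st Q E; exists c', D', Q'; split=> //; rewrite addn1.
have [|c' [Q' [D' [H1 H2 H3 H4 H5]]]] := st D; first by rewrite mulrC.
by exists c', D', Q'; split=> //; [rewrite mulrC | rewrite addn1].
Qed.

Lemma size_ev_factors (r : A) c F D Q :
  c.[r] != 0 -> (lead_coef F).[r] != 0 -> c *: F = D * Q ->
  size (ev r D) = size D /\ size (ev r Q) = size Q.
Proof.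
move=> cr Fr /(congr1 lead_coef); rewrite lead_coefZ lead_coefM => E.
have : (lead_coef D).[r] * (lead_coef Q).[r] != 0 by rewrite -hornerM -E hornerM mulf_neq0.
by rewrite mulf_eq0 negb_or => /andP[Dr Qr]; split; apply: size_map_poly_id0.
Qed.

(** A factorisation with denominator c is specialised at r without loss of degree, even where c
    vanishes. The coefficient ring A is only a domain, so that A may itself be a polynomial ring. *)
Lemma strip_eval (r : A) c F D Q :
  c != 0 -> (lead_coef F).[r] != 0 -> c *: F = D * Q ->
  exists (c0 : A) (D0 Q0 : {poly A}), [/\ c0 != 0, c0 *: ev r F = D0 * Q0,
    size D0 = size D & size Q0 = size Q].
Proof.
move=> c0 Fr /(strip_root r c0)[c' [D' [Q' [cr' E <- <- _]]]].
have [<- <-] := size_ev_factors cr' Fr E.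
exists c'.[r], (ev r D'), (ev r Q'); split=> //.
by rewrite -rmorphM -E /= map_polyZ.
Qed.

(** Otherwise the lowest term of d times the constant term of q would survive in a degree below
    n. *)
Lemma mul_eq_monomial (d q : {poly A}) (k : A) n : k != 0 ->
  d * q = k *: 'X^n -> (1 < size q)%N -> q`_0 = 0.
Proof.
move=> k0 E sq; have sE : size (d * q) = n.+1.
  by rewrite E -mul_polyC size_Cmul // size_polyXn.
have dq0 : d * q != 0 by rewrite -size_poly_eq0 sE.
have [d0 q0] : d != 0 /\ q != 0 by apply/andP; rewrite -negb_or -mulf_eq0.
have sd : (size d <= n)%N.
  have := size_mul d0 q0; rewrite sE.
  by case: (size q) sq => [|[|m]] //= _; rewrite !addnS /= => -[->]; rewrite leq_addr.
have ex : exists i, d`_i != 0.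
  by exists (size d).-1; rewrite -/(lead_coef d) lead_coef_eq0.
case: (ex_minnP ex) => i di imin.
apply/eqP; apply: contraT => q00.
have : (d * q)`_i != 0.
  rewrite coefM (bigD1 ord_max) //= subnn big1 ?addr0 ?mulf_neq0 // => j jmax.
  rewrite (_ : d`_j = 0) ?mul0r //; apply/eqP; apply: contraT => /imin.
  by rewrite leqNgt ltn_neqAle -ltnS ltn_ord andbT; move: jmax; rewrite -val_eqE /= => ->.
rewrite E coefZ coefXn; have [ni|_] := eqVneq i n; last by rewrite mulr0 eqxx.
by move: di; rewrite ni nth_default ?eqxx.
Qed.

(** At 0 the polynomial F becomes a monomial, so both factors have constant terms vanishing at 0,
    and c F_0 vanishes there to second order. *)
Lemma eisenstein_polyX c F D Q :
  c.[0] != 0 -> c *: F = D * Q -> (lead_coef F).[0] != 0 ->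
  (forall i, (i < (size F).-1)%N -> (F`_i).[0] = 0) -> (F`_0)`_1 != 0 ->
  (1 < size D)%N -> (1 < size Q)%N -> False.
Proof.
move=> c0 E Fl Fi F01 sD sQ.
have [sD0 sQ0] := size_ev_factors c0 Fl E.
have evE : ev 0 D * ev 0 Q = (c.[0] * (lead_coef F).[0]) *: 'X^((size F).-1).
  rewrite -rmorphM -E /= map_polyZ /= -[RHS]scalerA; congr (_ *: _).
  apply/polyP => i; rewrite coef_map coefZ coefXn /= /horner_eval.
  have [ilt|] := ltnP i (size F).-1; first by rewrite Fi // (ltn_eqF ilt) mulr0.
  rewrite leq_eqVlt => /orP[/eqP <-|gt]; first by rewrite eqxx mulr1.
  rewrite (gtn_eqF gt) mulr0 nth_default ?horner0 //.
  by apply: leq_trans gt; apply: leqSpred.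
have cl0 : c.[0] * (lead_coef F).[0] != 0 by rewrite mulf_neq0.
have evc (P : {poly {poly A}}) : (ev 0 P)`_0 = (P`_0).[0] by rewrite coef_map.
have Q00 : (Q`_0).[0] = 0.
  by rewrite -evc; apply: (mul_eq_monomial cl0 evE); rewrite sQ0.
have D00 : (D`_0).[0] = 0.
  rewrite -evc; rewrite mulrC in evE.
  by apply: (mul_eq_monomial cl0 evE); rewrite sD0.
have sF : (0 < (size F).-1)%N.
  have F0 : F != 0 by apply: contraNneq Fl => ->; rewrite lead_coef0 horner0.
  have c0' : c != 0 by apply: contraNneq c0 => ->; rewrite horner0.
  have DQ0 : D * Q != 0 by rewrite -E -mul_polyC mulf_neq0 ?polyC_eq0.
  have [D0 Q0] : D != 0 /\ Q != 0 by apply/andP; rewrite -negb_or -mulf_eq0.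
  have := size_mul D0 Q0; rewrite -E -mul_polyC size_Cmul // => ->.
  by move: sD sQ; case: (size D) => [|[|m]] //; case: (size Q) => [|[|p]] //= _ _; rewrite addnS.
have F00 := Fi 0%N sF; rewrite !horner_coef0 in F00 Q00 D00 c0.
have /polyP/(_ 0%N)/polyP/(_ 1%N) := E.
rewrite coefZ coef0M !coefM !big_ord_recl !big_ord0 /= F00 D00 Q00.
rewrite !(mulr0, mul0r, addr0) => /eqP; rewrite mulf_eq0 (negbTE c0) /=.
by rewrite (negbTE F01).
Qed.
End Strip.

(** The linear factors of c are cancelled one root at a time. *)
Lemma gauss_closed (K : closedFieldType) (c : {poly K}) (F D Q : {poly {poly K}}) :
  c != 0 -> c *: F = D * Q ->
  exists D1 Q1, [/\ F = D1 * Q1, size D1 = size D & size Q1 = size Q].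
Proof.
have [n] := ubnP (size c); elim: n c D Q => // n IHn c D Q cn c0 E.
have [/eqP/size_poly1P[k k0 ck]|/closed_rootP[r rc]] := eqVneq (size c) 1%N.
  exists (k^-1%:P *: D), Q; rewrite size_scale ?polyC_eq0 ?invr_eq0 //; split=> //.
  by rewrite -scalerAl -E ck scalerA -polyCM mulVf // scale1r.
have [c' [D' [Q' [cr' E' <- <-]]]] := strip_root r c0 E.
rewrite (eqP rc) eqxx addn1 => lt; apply: (IHn c') => //.
  by rewrite -ltnS (leq_trans _ cn).
by apply: contraNneq cr' => ->; rewrite horner0.
Qed.

Section Slice.
Context (K : fieldType) (k0 k1 k2 k3 k4 k5 k6 k7 : K).
Hypotheses (k0_neq0 : k0 != 0) (k7_neq0 : k7 != 0).

(* The variable of the inner polynomials is s, the outer one is t. *)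
Definition slice_poly : {poly {poly K}} :=
  (k0%:P * 'X ^+ 6 + k1%:P * 'X ^+ 10)%:P + (k2%:P * 'X ^+ 8)%:P * 'X
  + (k3%:P * 'X ^+ 6)%:P * 'X ^+ 2 + (k4%:P * 'X ^+ 4)%:P * 'X ^+ 3
  + (k5%:P * 'X ^+ 6 + k6%:P * 'X ^+ 2)%:P * 'X ^+ 4 + k7%:P%:P * 'X ^+ 5.

(* All roots t have valuation 6/5 at s = 0; after t = s t' and division by s^5
   the polynomial is Eisenstein. *)
Lemma slice_poly_factor D Q : slice_poly = D * Q -> (1 < size D)%N -> (1 < size Q)%N -> False.
Proof.
move=> E sD sQ; pose q : {poly {poly K}} := 'Y * 'X.
pose H : {poly {poly K}} := Poly [:: k0%:P * 'X + k1%:P * 'X ^+ 5; k2%:P * 'X ^+ 4;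
  k3%:P * 'X ^+ 3; k4%:P * 'X ^+ 2; k5%:P * 'X ^+ 5 + k6%:P * 'X; k7%:P].
have Hs : H = [:: k0%:P * 'X + k1%:P * 'X ^+ 5; k2%:P * 'X ^+ 4;
  k3%:P * 'X ^+ 3; k4%:P * 'X ^+ 2; k5%:P * 'X ^+ 5 + k6%:P * 'X; k7%:P] :> seq _.
  by apply: (PolyK (c := 0)); rewrite /= polyC_eq0.
have HE : 'X ^+ 5 *: H = (D \Po q) * (Q \Po q).
  rewrite -rmorphM /= -E /slice_poly /H /= !cons_poly_def mul0r add0r.
  rewrite !(comp_polyD, comp_polyM, comp_polyC, comp_Xn_poly) comp_polyX.
  by rewrite -mul_polyC /q !(rmorphD, rmorphM, rmorphXn) /=; ring.
have sq (P : {poly {poly K}}) : (1 < size P)%N -> (1 < size (P \Po q))%N.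
  move=> sP; have := size_comp_poly P q.
  have -> : size q = 2%N by rewrite /q size_Cmul ?polyX_eq0 // size_polyX.
  by rewrite muln1; case: (size P) sP => [|[|m]] // _; case: (size _) => [|[|]].
have X0 : 'X ^+ 5 != 0 :> {poly K} by rewrite expf_neq0 // polyX_eq0.
have [c' [D' [Q' [cr E' sD' sQ' _]]]] := strip_root 0 X0 HE.
apply: (eisenstein_polyX cr E').
- by rewrite lead_coefE Hs /= hornerC.
- rewrite Hs /= => i i5; case: i i5 => [|[|[|[|[|//]]]]] _ /=;
    by rewrite ?(hornerD, hornerM, hornerC, hornerXn, hornerX) ?expr0n /= ?mulr0 ?addr0.
- by rewrite Hs /= coefD !coefCM coefX coefXn /= mulr1 mulr0 addr0.
- by rewrite sD'; exact: sq.
- by rewrite sQ'; exact: sq.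
Qed.

(** Here s is the outer variable. By [slice_poly_factor] one factor has degree 0 in t; being a
    polynomial in s that divides the constant leading coefficient k7, it is constant in s as
    well. *)
Lemma slice_irreducible (D Q : {poly {poly K}}) :
  swapXY slice_poly = D * Q -> size D = 1%N \/ size Q = 1%N.
Proof.
move=> /(congr1 (@swapXY _)); rewrite swapXYK rmorphM /= => E.
have lE : lead_coef slice_poly = k7%:P.
  have -> : slice_poly = Poly [:: k0%:P * 'X ^+ 6 + k1%:P * 'X ^+ 10; k2%:P * 'X ^+ 8;
     k3%:P * 'X ^+ 6; k4%:P * 'X ^+ 4; k5%:P * 'X ^+ 6 + k6%:P * 'X ^+ 2; k7%:P].
    by rewrite /slice_poly /= !cons_poly_def mul0r add0r; ring.
  by rewrite lead_coefE (PolyK (c := 0)) /= ?polyC_eq0.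
have S0 : slice_poly != 0 by rewrite -lead_coef_eq0 lE polyC_eq0.
have DQ (P T : {poly {poly K}}) : slice_poly = swapXY P * swapXY T ->
    (size (swapXY P) <= 1)%N -> size P = 1%N.
  move=> ES /size1_polyC PE.
  have := congr1 (@lead_coef _) ES; rewrite lE lead_coefM PE lead_coefC =>
    /(congr1 (fun p : {poly K} => size p)).
  have p0 : (swapXY P)`_0 != 0.
    by apply: contraNneq S0 => p0; rewrite ES PE p0 mul0r.
  have t0 : lead_coef (swapXY T) != 0.
    by rewrite lead_coef_eq0; apply: contraNneq S0 => T0; rewrite ES T0 mulr0.
  rewrite size_polyC k7_neq0 size_mul // => sz.
  have /size_poly1P[k kn kE] : size (swapXY P)`_0 == 1%N.
    move: p0 t0 sz; rewrite -!size_poly_gt0.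
    case: (size (swapXY P)`_0) => [|[|m]] // _.
    by case: (size (polyseq (lead_coef _))) => [|m'] // _ /=; rewrite addnS.
  by rewrite -(swapXYK P) PE kE swapXY_polyC map_polyC size_polyC polyC_eq0 kn.
have [sD|sD] := leqP (size (swapXY D)) 1; first by left; apply: DQ E sD.
right; apply: (DQ Q D); first by rewrite mulrC.
by rewrite leqNgt; apply/negP => sQ; apply: slice_poly_factor E sD sQ.
Qed.
End Slice.

(** * Polynomials along parallel lines *)

Lemma mpoly_morph_eq (K : comNzRingType) (L : comNzRingType) n
    (f g : {rmorphism mpoly n K -> L}) :
  (forall c, f (mpolyC n c) = g (mpolyC n c)) ->
  (forall i, f (mpolyX K (mnm1 i)) = g (mpolyX K (mnm1 i))) -> f =1 g.
Proof.
move=> fC fX P; rewrite (mpolyE P) !rmorph_sum; apply: eq_bigr => m _ /=.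
rewrite -mul_mpolyC !rmorphM /= fC; congr (_ * _).
rewrite mpolyXE_id !rmorph_prod; apply: eq_bigr => i _.
by rewrite !rmorphXn /= fX.
Qed.

Lemma digits_inj n b (m m' : 'I_n -> nat) :
  (forall i, m i < b)%N -> (forall i, m' i < b)%N ->
  (\sum_(i < n) m i * b ^ i = \sum_(i < n) m' i * b ^ i)%N -> m =1 m'.
Proof.
elim: n m m' => [|n IHn] m m' mb mb' E i; first by case: i.
have S (l : 'I_n.+1 -> nat) : (\sum_(i < n.+1) l i * b ^ i =
    l ord0 + (\sum_(i < n) l (lift ord0 i) * b ^ i) * b)%N.
  rewrite big_ord_recl expn0 muln1 big_distrl /=; congr (_ + _)%N.
  by apply: eq_bigr => j _; rewrite /bump /= add1n expnSr mulnA.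
rewrite !S in E; have b0 : (0 < b)%N by apply: leq_ltn_trans (mb ord0).
have E0 : m ord0 = m' ord0.
  by have := congr1 (modn^~ b) E; rewrite /= ![(_ + _ * b)%N]addnC !modnMDl !modn_small.
move: E; rewrite E0 => /addnI /eqP; rewrite eqn_pmul2r // => /eqP E1.
have IH := IHn (fun i => m (lift ord0 i)) (fun i => m' (lift ord0 i)) (fun i => mb _) (fun i => mb' _) E1.
by have [j ->|->] := unliftP ord0 i; [exact: IH | exact: E0].
Qed.

Lemma poly_nonzero_point (K : numDomainType) (q : {poly K}) : q != 0 ->
  exists N : nat, q.[N%:R] != 0.
Proof.
move=> q0; apply: contrapT => no; move: q0; apply/negP; rewrite negbK.
have := @max_poly_roots _ q [seq n%:R | n <- iota 0 (size q)].
rewrite size_map size_iota ltnn; case: eqP => // _ H; exfalso; apply/notF/H => //.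
  apply/allP => _ /mapP[k _ ->]; apply/negP => /negP rk; apply: no.
  by exists k.
by rewrite map_inj_uniq ?iota_uniq // => k l /eqP; rewrite eqr_nat => /eqP.
Qed.

(* Kronecker substitution. *)
Lemma mpoly_nonzero_point (K : numDomainType) n (P : mpoly n K) : P != 0 ->
  exists x : 'I_n -> nat, meval (fun i => (x i)%:R) P != 0.
Proof.
move=> P0; pose b := mmeasure mdeg P; pose e (m : multinom n) := (\sum_(i < n) m i * b ^ i)%N.
have small m i : m \in msupp P -> (m i < b)%N.
  move=> mP; apply: leq_ltn_trans (mmeasure_mnm_lt _ mP).
  by rewrite /= mdegE (bigD1 i) //= leq_addr.
pose q : {poly K} := mmap (@polyC K) (fun i : 'I_n => 'X^(b ^ i)) P.
have qE : q = \sum_(m <- msupp P) mcoeff m P *: 'X^(e m).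
  apply: eq_bigr => m _; rewrite mul_polyC; congr (_ *: _).
  rewrite /mmap1 /e; elim/big_rec2: _ => [|i y1 y2 _ ->]; first by rewrite expr0.
  by rewrite -exprM exprD mulnC.
have [m0 m0P] : exists m, m \in msupp P.
  by exists (mlead P); apply: mlead_supp.
have q0 : q != 0.
  suff : q`_(e m0) != 0 by apply: contraNneq => ->; rewrite coef0.
  rewrite qE coef_sum (bigD1_seq m0) ?msupp_uniq //= big_seq_cond big1 => [|m /andP[mP mm0]].
    by rewrite addr0 coefZ coefXn eqxx mulr1 -mcoeff_msupp.
  rewrite coefZ coefXn (_ : (e m0 == e m) = false) ?mulr0 //.
  apply: contraNF mm0 => /eqP /digits_inj H; apply/eqP/mnmP => i; apply/esym/H => j; exact: small.
have [N qN] := poly_nonzero_point q0.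
exists (fun i => N ^ (b ^ i))%N; move: qN; rewrite /q /mmap mevalE horner_sum.
congr (_ != 0); apply: eq_bigr => m _; rewrite hornerM hornerC horner_prod; congr (_ * _).
by apply: eq_bigr => i _; rewrite horner_exp hornerXn natrX.
Qed.

(** The value x may be zero, so products and sums need no discussion of vanishing leading
    coefficients. *)
Definition top_coef (A : comNzRingType) (p : {poly A}) d (x : A) :=
  (size p <= d.+1)%N /\ p`_d = x.

Lemma top_coefM (A : comNzRingType) (p q : {poly A}) d e x y :
  top_coef p d x -> top_coef q e y -> top_coef (p * q) (d + e) (x * y).
Proof.
move=> [sp px] [sq qy]; split.
  by apply: leq_trans (size_polyMleq _ _) _; rewrite -subn1 leq_subLR add1n -addSn -addnS leq_add.
have dde : (d < (d + e).+1)%N by rewrite ltnS leq_addr.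
rewrite coefM (bigD1 (Ordinal dde)) //= addKn px qy big1 ?addr0 // => j jd.
have [jlt|] := ltnP j d.
  rewrite [q`__]nth_default ?mulr0 //; apply: leq_trans sq _.
  by rewrite ltn_subRL ltn_add2r.
rewrite leq_eqVlt => /orP[/eqP dj|dj]; first by case/eqP: jd; apply: val_inj.
by rewrite nth_default ?mul0r // (leq_trans sp).
Qed.

Lemma top_coef_linear (A : comNzRingType) (x y : A) k :
  top_coef ((x%:P + y%:P * 'X) ^+ k) k (y ^+ k).
Proof.
elim: k => [|k IHk]; first by split; rewrite ?size_poly1 ?coef1.
rewrite !exprS -add1n; apply: top_coefM IHk; split.
  rewrite addrC -cons_poly_def size_cons_poly.
  by case: ifP => // _; rewrite ltnS size_polyC leq_b1.
by rewrite coefD coefCM coefX coefC add0r mulr1.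
Qed.

Lemma top_coef_mmap1 (A : comNzRingType) n (x y : 'I_n -> A) (m : multinom n) :
  top_coef (mmap1 (fun i => (x i)%:P + (y i)%:P * 'X) m) (mdeg m) (\prod_(i < n) y i ^+ m i).
Proof.
rewrite /mmap1 mdegE; elim/big_rec3: _ => [|i z e p _ IH].
  by split; rewrite ?size_poly1 ?coef1.
exact: top_coefM (top_coef_linear _ _ _) IH.
Qed.

Lemma top_coef_sum (A : comNzRingType) (I : eqType) (s : seq I) (c : I -> A) (p : I -> {poly A}) x d :
  {in s, forall i, top_coef (p i) d (x i)} ->
  top_coef (\sum_(i <- s) (c i)%:P * p i) d (\sum_(i <- s) c i * x i).
Proof.
elim: s => [|i s IHs] hs; first by rewrite !big_nil; split; rewrite ?size_poly0 ?coef0.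
have [s1 c1] := IHs (fun m ms => hs m (mem_behead (s := i :: s) ms)).
have [s2 c2] := hs i (mem_head _ _).
rewrite !big_cons mul_polyC; split.
  rewrite (leq_trans (size_polyD _ _)) // geq_max s1 andbT.
  exact: leq_trans (size_scale_leq _ _) s2.
by rewrite coefD c1 coefZ c2.
Qed.

Section Line.
Context (K : numFieldType) (n : nat) (v : 'I_n -> K).
Implicit Types (P : mpoly n K).

(* P(a + Z v), as a polynomial in Z with coefficients in K[a]. *)
Definition line_poly P : {poly mpoly n K} :=
  mmap (polyC \o @mpolyC n K)
    (fun i => (mpolyX K (mnm1 i))%:P + (mpolyC n (v i))%:P * 'X) P.

Lemma line_polyM P Q : line_poly (P * Q) = line_poly P * line_poly Q.
Proof. exact: rmorphM. Qed.

Lemma horner_line_poly (L : comNzRingType) (f : {rmorphism mpoly n K -> L}) P (z : L) :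
  (map_poly f (line_poly P)).[z] =
    mmap (f \o @mpolyC n K) (fun i => f (mpolyX K (mnm1 i)) + f (mpolyC n (v i)) * z) P.
Proof.
pose g : {rmorphism mpoly n K -> L} :=
  mmap (f \o @mpolyC n K) (fun i => f (mpolyX K (mnm1 i)) + f (mpolyC n (v i)) * z).
pose h : {rmorphism mpoly n K -> L} :=
  horner_eval z \o map_poly f \o mmap (polyC \o @mpolyC n K)
    (fun i => (mpolyX K (mnm1 i))%:P + (mpolyC n (v i))%:P * 'X).
apply: (@mpoly_morph_eq _ _ _ h g) => [c|i] /=.
  by rewrite /g /h /= !mmapC /= map_polyC /horner_eval hornerC.
rewrite /g /h /= !mmapX !mmap1U rmorphD rmorphM /= !map_polyC map_polyX.
by rewrite /horner_eval !hornerE.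
Qed.

Lemma meval_line_poly (a : 'I_n -> K) P z :
  (map_poly (meval a) (line_poly P)).[z] = meval (fun i => a i + z * v i) P.
Proof.
rewrite horner_line_poly /meval /mmap; apply: eq_bigr => m _; congr (_ * _).
  by rewrite /= mevalC.
apply: eq_bigr => i _ /=; congr (_ ^+ _).
have -> : meval a (mpolyX K (mnm1 i)) = a i by apply: mevalXU.
by rewrite mevalC mulrC.
Qed.

Lemma line_poly_horner0 P : (line_poly P).[0] = P.
Proof.
have := horner_line_poly idfun P 0; rewrite map_poly_id // => ->.
rewrite [RHS]mpolyE /mmap; apply: eq_bigr => m _; rewrite /= mul_mpolyC; congr (_ *: _).
rewrite mpolyXE_id; apply: eq_bigr => i _.
by rewrite mulr0 addr0.
Qed.

Lemma line_poly_size1 P : (size (line_poly P) <= 1)%N -> line_poly P = P%:P.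
Proof.
move=> /size1_polyC; set c := (line_poly P)`_0; move: c => c E.
by have := line_poly_horner0 P; rewrite E hornerC => ->.
Qed.

Lemma rmorph_meval (A : comNzRingType) (f : {rmorphism K -> A}) P :
  f (meval v P) = \sum_(m <- msupp P) f (mcoeff m P) * \prod_(i < n) f (v i) ^+ m i.
Proof.
rewrite mevalE rmorph_sum; apply: eq_bigr => m _; rewrite rmorphM rmorph_prod.
by congr (_ * _); apply: eq_bigr => i _; rewrite rmorphXn.
Qed.

(** In each monomial of degree d the coefficient of Z^d arises by taking Z v_i from every factor, so
    a does not occur in it. *)
Lemma line_poly_top P d : P \is ishomog1 d mdeg ->
  top_coef (line_poly P) d (mpolyC n (meval v P)).
Proof.
move=> /dhomogP hP; rewrite (rmorph_meval (@mpolyC n K)).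
apply: top_coef_sum => m mP; rewrite -(hP m mP).
exact: top_coef_mmap1.
Qed.
End Line.

(** A nonzero P is nonzero at some integral, hence real, point x; on the line from p to x it would
    have infinitely many roots near p. *)
Lemma mpoly_eq0_near (R : realType) n (P : mpoly n R[i]) (p : 'rV[R]_n) :
  (\forall a \near p, meval (complexify a 0) P = 0) -> P = 0.
Proof.
move=> nearP; apply/eqP; apply: contraT => /mpoly_nonzero_point[x xP].
pose w : 'rV[R]_n := \row_i (x i)%:R - p.
pose q := map_poly (meval (complexify p 0)) (line_poly (complexify w 0) P).
have qE (t : R) : q.[(t%:C)%C] = meval (complexify (p + t *: w) 0) P.
  rewrite meval_line_poly; apply: meval_eq => i.
  by rewrite !mxE [RHS]rmorphD /= rmorphM.
have q0 : q != 0.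
  apply: contraNneq xP => q0; have := qE 1; rewrite q0 horner0 => /esym/eqP; congr (_ == 0).
  by apply: meval_eq => i; rewrite scale1r /w addrC subrK !mxE rmorph_nat.
have gc : continuous (fun t : R => p + t *: w).
  by move=> u; apply: cvgD; [exact: cvg_cst | exact: scalel_continuous].
have := gc 0; rewrite /continuous_at scale0r addr0 => /(_ _ nearP).
rewrite nbhs_simpl /= => /nbhs_ballP[e /= e0 ballP].
have := @max_poly_roots _ q [seq ((e / (k.+2)%:R)%:C)%C | k <- iota 0 (size q)].
rewrite size_map size_iota ltnn => /(_ q0) H; exfalso; apply/notF/H.
  apply/allP => _ /mapP[k _ ->]; rewrite /root qE; apply/eqP/ballP.
  rewrite -ball_normE /= sub0r normrN gtr0_norm ?divr_gt0 ?ltr0n //.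
  by rewrite gtr_pMr // invf_lt1 ?ltr0n // ltr1n.
rewrite map_inj_uniq ?iota_uniq // => k l /complexI.
by move/(mulfI (lt0r_neq0 e0))/invr_inj/eqP; rewrite eqr_nat => /eqP[].
Qed.

(** A zero resultant gives a nonconstant common divisor over the field of fractions, associated to F
    by irreducibility; the unit leading coefficient makes the division by F exact over A. *)
Lemma irreducible_dvd (A : idomainType) (F G : {poly A}) :
  (1 < size F)%N -> lead_coef F \is a GRing.unit ->
  (forall c D Q, c != 0 -> c *: F = D * Q -> size D = 1%N \/ size Q = 1%N) ->
  resultant F G = 0 -> exists H, G = H * F.
Proof.
move=> sF uF irr /eqP; rewrite resultant_eq0 => sD.
have [[c Q] /= c0 E] := Pdiv.Idomain.dvdpP _ _ (dvdp_gcdl F G).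
have F0 : F != 0 by rewrite -size_poly_gt0 ltnW.
have [sQ|] := irr c Q _ c0 E; last by move=> s1; rewrite s1 in sD.
have DF : gcdp F G %= F.
  rewrite -dvdp_size_eqp ?dvdp_gcdl //.
  have /size_poly1P[k k0 Qk] : size Q == 1%N by rewrite sQ.
  by rewrite -(size_scale F c0) E Qk mul_polyC size_scale.
have : F %| G by rewrite -(eqp_dvdl _ DF) dvdp_gcdr.
by move/(Pdiv.IdomainUnit.dvdpP uF) => [H ->]; exists H.
Qed.

(** * Homogeneity of the discriminant *)

Section Homogeneity.
Context (n : nat) (K : idomainType).
Local Notation homog d := (ishomog1 (n := n) (R := K) d mdeg).

Lemma dhomogB d P Q : P \is homog d -> Q \is homog d -> P - Q \is homog d.
Proof. exact: rpredB. Qed.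

Lemma dhomog_mulrn d P k : P \is homog d -> P *+ k \is homog d.
Proof. exact: rpredMn. Qed.

Lemma dhomog_sum d (I : eqType) (s : seq I) (F : I -> mpoly n K) :
  (forall i, i \in s -> F i \is homog d) -> \sum_(i <- s) F i \is homog d.
Proof. by move=> h; rewrite big_seq; apply: rpred_sum. Qed.

Lemma dhomog_nat k : (k%:R : mpoly n K) \is homog 0.
Proof. by apply: dhomog_mulrn; exact: dhomog1. Qed.

Lemma dhomog_prod_sum (I : Type) (s : seq I) (F : I -> mpoly n K) (d : I -> nat) :
  (forall i, F i \is homog (d i)) -> \prod_(i <- s) F i \is homog (\sum_(i <- s) d i).
Proof.
move=> h; elim/big_rec2: _ => [|i e P _ IH]; first exact: dhomog1.
exact: dhomogM.
Qed.

Context (A : nat -> nat -> nat -> mpoly n K).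
Hypothesis homA : forall i j k, A i j k \is homog 1.

Let homN k m : sc_N A k m \is homog 2.
Proof.
apply: dhomog_sum => j _; apply: dhomog_sum => l _.
by apply: dhomogB; exact: dhomogM (homA _ _ _) (homA _ _ _).
Qed.

Let homc k m : sc_c A k m \is homog 2.
Proof.
apply: dhomogB; apply: dhomog_mulrn => //; apply: dhomogM (dhomog_nat _) _.
exact: dhomog_sum.
Qed.

Let homd k : sc_d A k \is homog 3.
Proof.
apply: dhomog_sum => j _; apply: dhomog_sum => l _.
by apply: dhomogB; exact: dhomogM (homA _ _ _) (homc _ _).
Qed.

Let home : sc_e A \is homog 4.
Proof.
apply: dhomog_sum => l _; apply: dhomogB; first exact: dhomogM (homc _ _) (homc _ _).
by apply: dhomog_mulrn; exact: dhomogM (homA _ _ _) (homd _).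
Qed.

(* y_5 has degree 2. *)
Definition weight (j : nat) : nat := match j with 0 => 0 | 4 => 2 | _ => 1 end%N.

(** Subtraction of naturals is truncated, hence the separate branch: entries of negative degree
    vanish. *)
Lemma sc_dhomog k i j : (k < 5)%N -> (i < 5)%N -> (j < 5)%N ->
  if (weight k + weight i < weight j)%N then sc A k i j = 0
  else sc A k i j \is homog (weight k + weight i - weight j).
Proof.
by case: k => [|[|[|[|[|k]]]]] //; case: i => [|[|[|[|[|i]]]]] //;
   case: j => [|[|[|[|[|j]]]]] //= _ _ _;
   first [by [] | exact: dhomog0 | exact: dhomog1 | exact: dhomog_nat | exact: homc | exact: homd
         | exact: home | by apply: dhomog_mulrn | by apply: dhomog_mulrn; exact: dhomog0].
Qed.

Lemma sc_tr_dhomog k : (k < 5)%N -> sc_tr A k \is homog (weight k).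
Proof.
move=> k5; rewrite /sc_tr big_mkord; apply: dhomog_sum => i _.
by have := sc_dhomog k5 (ltn_ord i) (ltn_ord i); rewrite ltnNge leq_addl addnK.
Qed.

Lemma trace_entry_dhomog j k : (j < 5)%N -> (k < 5)%N ->
  trace_entry A j k \is homog (weight j + weight k).
Proof.
move=> j5 k5; rewrite /trace_entry big_mkord; apply: dhomog_sum => l _.
have := sc_dhomog j5 k5 (ltn_ord l); case: ltnP => [_ ->|le h]; first by rewrite mul0r dhomog0.
by rewrite -(subnK le); apply: dhomogM h (sc_tr_dhomog _).
Qed.

(** Each term of the determinant has degree twice the total weight 0 + 1 + 1 + 1 + 2. *)
Lemma disc_dhomog : disc A \is homog 10.
Proof.
have hprod (s : {perm 'I_5}) : \prod_i trace_form A i (s i) \is homog 10.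
  have -> : 10%N = (\sum_(i < 5) (weight i + weight (s i)))%N.
    rewrite big_split /=.
    have -> : (\sum_(i < 5) weight (s i) = \sum_(i < 5) weight i)%N.
      by rewrite [RHS](reindex_inj (@perm_inj _ s)).
    by rewrite !big_ord_recr big_ord0.
  by apply: dhomog_prod_sum => i; rewrite mxE trace_entry_dhomog.
by apply: dhomog_sum => s _; rewrite -signr_odd mulr_sign; case: odd; rewrite ?dhomogN hprod.
Qed.
End Homogeneity.

(** * Explicit discriminants *)

(** Indices are naturals, so that for a fixed n the expansion reduces to an expression that [ring]
    can treat. *)
Fixpoint laplace (K : pzRingType) n (f : nat -> nat -> K) : K :=
  if n is m.+1 then \sum_(0 <= j < n)
    f 0%N j * ((-1) ^+ j * laplace m (fun a b => f a.+1 (bump j b)))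
  else 1.

Lemma det_laplace (K : comNzRingType) n (f : nat -> nat -> K) :
  \det (\matrix_(i < n, j < n) f i j) = laplace n f.
Proof.
elim: n f => [|n IHn] f; first by rewrite det_mx00.
rewrite (expand_det_row _ ord0) [RHS]big_mkord; apply: eq_bigr => j _; rewrite mxE.
congr (_ * (_ * _)); apply: etrans (IHn _); congr (\det _); apply/matrixP => a b; rewrite !mxE.
by rewrite /= /bump leq0n add1n.
Qed.

Section SparseTensors.
Context (K : comNzRingType) (A : nat -> nat -> nat -> K).
Hypothesis symA : symmetric3 A.
Let sA := symmetric3_sort symA.

(** The trace form on the family of cubics with A_111 = X = - A_122, A_112 = W = - A_222, A_123 = S;
    below, [line_trace] keeps only A_111 = X and A_123 = S. *)
Definition slice_trace (X W S : K) (j k : nat) : K :=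
  match j, k with
  | 0%N, 0%N => 5 | 0%N, 4%N | 4%N, 0%N => 8 * (X ^+ 2 + W ^+ 2) + 12 * S ^+ 2
  | 1%N, 1%N | 2%N, 2%N => 96 * (X ^+ 2 + W ^+ 2) + 64 * S ^+ 2
  | 3%N, 3%N => 64 * S ^+ 2 - 64 * (X ^+ 2 + W ^+ 2)
  | 1%N, 3%N | 3%N, 1%N => 160 * W * S | 2%N, 3%N | 3%N, 2%N => - 160 * X * S
  | 1%N, 4%N | 4%N, 1%N => - 320 * X * S ^+ 2 | 2%N, 4%N | 4%N, 2%N => 320 * W * S ^+ 2
  | 4%N, 4%N => 5 * ((8 * (X ^+ 2 + W ^+ 2) + 4 * S ^+ 2) ^+ 2 + 128 * (X ^+ 2 + W ^+ 2) * S ^+ 2)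
  | _, _ => 0
  end.

Definition line_trace (X S : K) (j k : nat) : K :=
  match j, k with
  | 0%N, 0%N => 5 | 0%N, 1%N | 1%N, 0%N => 4 * X | 0%N, 4%N | 4%N, 0%N => 12 * S ^+ 2
  | 1%N, 1%N => 64 * S ^+ 2 + 16 * X ^+ 2 | 2%N, 2%N | 3%N, 3%N => 64 * S ^+ 2
  | 2%N, 3%N | 3%N, 2%N => - 64 * X * S | 1%N, 4%N | 4%N, 1%N => - 144 * X * S ^+ 2
  | 4%N, 4%N => 80 * S ^+ 4 + 256 * X ^+ 2 * S ^+ 2
  | _, _ => 0
  end.

Hypothesis A0 : ((A 1 1 3 = 0) * (A 1 3 3 = 0) * (A 2 2 3 = 0) * (A 2 3 3 = 0) * (A 3 3 3 = 0))%type.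

Lemma trace_entry_slice j k : A 1 2 2 = - A 1 1 1 -> A 2 2 2 = - A 1 1 2 ->
  (j < 5)%N -> (k < 5)%N ->
  trace_entry A j k = slice_trace (A 1 1 1) (A 1 1 2) (A 1 2 3) j k.
Proof.
move=> A122 A222; have := (A0, A122, A222).
move AX: (A 1 1 1) => X; move AW: (A 1 1 2) => W; move AS: (A 1 2 3) => S vA;
 have cE : (
   (sc_c A 1 1 = (8 * (X ^+ 2 + W ^+ 2) + 4 * S ^+ 2)%R) * (sc_c A 1 2 = 0) *
   (sc_c A 1 3 = (16 * W * S)%R) * (sc_c A 2 2 = (8 * (X ^+ 2 + W ^+ 2) + 4 * S ^+ 2)%R) *
   (sc_c A 2 3 = (- 16 * X * S)%R) * (sc_c A 3 3 = (4 * S ^+ 2 - 8 * (X ^+ 2 + W ^+ 2))%R))%type.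
  by do !split; rewrite (sc_cE symA) ?vA ?AX ?AW ?AS; ring.
have cC := sc_cC symA.
have dE : ((sc_d A 1 = (- 32 * X * S ^+ 2)%R) * (sc_d A 2 = (32 * W * S ^+ 2)%R) * (sc_d A 3 = 0))%type.
  by do !split; rewrite /sc_d !sum_1_4 !cC !cE !sA !vA ?AX ?AW ?AS; ring.
have eE : sc_e A = (8 * (X ^+ 2 + W ^+ 2) + 4 * S ^+ 2) ^+ 2 + 128 * (X ^+ 2 + W ^+ 2) * S ^+ 2.
  by rewrite /sc_e !sum_1_4 !dE !cE !vA ?AX ?AW; ring.
by case: j => [|[|[|[|[|j]]]]] //; case: k => [|[|[|[|[|k]]]]] // _ _;
   rewrite /trace_entry /sc_tr !sum_0_5 /sc /sc_gen /= ?cC ?cE ?dE ?eE ?sA ?vA ?AX ?AW ?AS; ring.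
Qed.

Lemma trace_entry_line j k : A 1 1 2 = 0 -> A 1 2 2 = 0 -> A 2 2 2 = 0 ->
  (j < 5)%N -> (k < 5)%N ->
  trace_entry A j k = line_trace (A 1 1 1) (A 1 2 3) j k.
Proof.
move=> A112 A122 A222; have := (A0, A112, A122, A222).
move AX: (A 1 1 1) => X; move AS: (A 1 2 3) => S vA;
 have cE : (
   (sc_c A 1 1 = (4 * S ^+ 2)%R) * (sc_c A 1 2 = 0) * (sc_c A 1 3 = 0) * (sc_c A 2 2 = (4 * S ^+ 2)%R) *
   (sc_c A 2 3 = (- 8 * X * S)%R) * (sc_c A 3 3 = (4 * S ^+ 2)%R))%type.
  by do !split; rewrite (sc_cE symA) ?vA ?AX ?AS; ring.
have cC := sc_cC symA.
have dE : ((sc_d A 1 = (- 16 * X * S ^+ 2)%R) * (sc_d A 2 = 0) * (sc_d A 3 = 0))%type.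
  by do !split; rewrite /sc_d !sum_1_4 !cC !cE !sA !vA ?AX ?AS; ring.
have eE : sc_e A = 16 * S ^+ 4 + 64 * X ^+ 2 * S ^+ 2.
  by rewrite /sc_e !sum_1_4 !dE !cE !vA ?AX; ring.
by case: j => [|[|[|[|[|j]]]]] //; case: k => [|[|[|[|[|k]]]]] // _ _;
   rewrite /trace_entry /sc_tr !sum_0_5 /sc /sc_gen /= ?cC ?cE ?dE ?eE ?sA ?vA ?AX ?AS; ring.
Qed.

Lemma disc_slice : A 1 2 2 = - A 1 1 1 -> A 2 2 2 = - A 1 1 2 ->
  disc A = laplace 5 (slice_trace (A 1 1 1) (A 1 1 2) (A 1 2 3)).
Proof.
move=> A122 A222; rewrite -det_laplace; congr (\det _).
by apply/matrixP => j k; rewrite !mxE trace_entry_slice.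
Qed.
End SparseTensors.

Lemma laplace_line (K : comNzRingType) (X S : K) :
  laplace 5 (line_trace X S) = 2 ^+ 26 * S ^+ 4 * (S ^+ 2 - X ^+ 2) ^+ 3.
Proof.
by rewrite /laplace unlock /= ?(mul0r, add0r, addr0, mulr0, mulr1); ring.
Qed.

Lemma laplace_slice (K : comNzRingType) (X W S : K) :
  let N := X ^+ 2 + W ^+ 2 in
  let u := 96 * N + 64 * S ^+ 2 in
  let y := 64 * S ^+ 2 - 64 * N in
  laplace 5 (slice_trace X W S) =
    (25 * ((8 * N + 4 * S ^+ 2) ^+ 2 + 128 * N * S ^+ 2) - (8 * N + 12 * S ^+ 2) ^+ 2)
      * u * (u * y - 160 ^+ 2 * N * S ^+ 2)
    - 5 * 320 ^+ 2 * N * S ^+ 4 * u * y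
    + 5 * (320 * 160) ^+ 2 * S ^+ 6 * (X ^+ 2 - W ^+ 2) ^+ 2.
Proof.
by move=> N u y; rewrite /laplace unlock /= ?(mul0r, add0r, addr0, mulr0, mulr1) /u /y /N; ring.
Qed.

(** The expansion of [laplace_slice] at X = 1 + t, W = i (t - 1), where X^2 + W^2 = 4 t and X^2 -
    W^2 = 2 (1 + t^2). *)
Definition slice_disc (K : closedFieldType) : {poly {poly K}} :=
  slice_poly (2 ^+ 24 * 3125) (2 ^+ 26) (- (2 ^+ 27 * 35)) (2 ^+ 25 * 45) (- (2 ^+ 29 * 1305))
    (2 ^+ 24 * 3125) (- (2 ^+ 32 * 405)) (- (2 ^+ 35 * 27)).

Lemma horner_slice_disc (K : closedFieldType) (t s i : K) : i ^+ 2 = -1 ->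
  ((slice_disc K).[t%:P]).[s] = laplace 5 (slice_trace (1 + t) (i * (t - 1)) s).
Proof.
move=> i2; rewrite laplace_slice exprMn i2 /slice_disc /slice_poly
  !(hornerD, hornerM, hornerX, hornerC, horner_exp).
ring.
Qed.

Lemma posdef_line (R : realFieldType) (A : nat -> nat -> nat -> R) :
  (forall j k, (j < 5)%N -> (k < 5)%N -> trace_entry A j k = line_trace 1 2 j k) ->
  posdef (trace_form A).
Proof.
move=> AT y y0; pose Y (n : nat) : R := y 0 (inord n).
have -> : (y *m trace_form A *m y^T) 0 0 =
    \sum_(0 <= j < 5) (\sum_(0 <= i < 5) Y i * line_trace 1 2 i j) * Y j.
  rewrite mxE big_mkord; apply: eq_bigr => j _; rewrite mxE mxE big_mkord /Y inord_val.
  by congr (_ * _); apply: eq_bigr => i _; rewrite mxE inord_val AT.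
have Y0 : [|| Y 0%N != 0, Y 1%N != 0, Y 2%N != 0, Y 3%N != 0 | Y 4%N != 0].
  apply: contraNT y0; rewrite !negb_or !negbK => /and5P[/eqP h0 /eqP h1 /eqP h2 /eqP h3 /eqP h4].
  apply/eqP/rowP => j; rewrite mxE -(inord_val j).
  by case: j => [[|[|[|[|[|j]]]]] jlt].
rewrite !sum_0_5 /=.
set Q := (X in 0 < X).
(* A sum of squares whose terms vanish together only at 0. *)
have QE : Q = (16 * Y 4%N + Y 0%N / 3 - 4 * Y 1%N) ^+ 2 * 9 + (Y 0%N + 4 * Y 1%N) ^+ 2 * 4
   + Y 1%N ^+ 2 * 64 + Y 2%N ^+ 2 * 128 + Y 3%N ^+ 2 * 128 + (4 * Y 2%N - 4 * Y 3%N) ^+ 2 * 8.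
  by rewrite /Q; field.
rewrite ltNge; apply: contraL Y0 => Qle; rewrite !negb_or !negbK.
move: (Y 0%N) (Y 1%N) (Y 2%N) (Y 3%N) (Y 4%N) QE => Y0 Y1 Y2 Y3 Y4 QE.
have := (sqr_ge0 (16 * Y4 + Y0 / 3 - 4 * Y1), sqr_ge0 (Y0 + 4 * Y1), sqr_ge0 Y1,
  sqr_ge0 Y2, sqr_ge0 Y3, sqr_ge0 (4 * Y2 - 4 * Y3)).
rewrite QE in Qle; clear QE Q.
have sq0 (z : R) : z ^+ 2 <= 0 -> 0 <= z ^+ 2 -> z = 0.
  by move=> zl zg; apply/eqP; rewrite -sqrf_eq0 eq_le zl zg.
move=> [[[[[q1 q2] q3] q4] q5] q6].
have Y1E : Y1 = 0 by apply: sq0 => //; lra.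
have Y2E : Y2 = 0 by apply: sq0 => //; lra.
have Y3E : Y3 = 0 by apply: sq0 => //; lra.
have Z0 : Y0 + 4 * Y1 = 0 by apply: sq0 => //; lra.
have Z4 : 16 * Y4 + Y0 / 3 - 4 * Y1 = 0 by apply: sq0 => //; lra.
have Y0E : Y0 = 0 by lra.
have Y4E : Y4 = 0 by lra.
by rewrite Y0E Y1E Y2E Y3E Y4E !eqxx.
Qed.

Lemma poly2_eq0 (K : numDomainType) (P : {poly {poly K}}) :
  (forall x y, P.[x%:P].[y] = 0) -> P = 0.
Proof.
move=> ev0; apply/eqP; apply: contraT; rewrite -lead_coef_eq0 => /poly_nonzero_point[t Pt].
have /poly_nonzero_point[z] : map_poly (horner_eval t%:R) P != 0.
  by apply: contraNneq Pt => E; rewrite lead_coefE -/(horner_eval _ _) -coef_map E coef0.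
have -> : (map_poly (horner_eval t%:R) P).[z%:R] = P.[z%:R%:P].[t%:R].
  by rewrite -/(horner_eval t%:R _) -horner_map /= /horner_eval hornerC.
by rewrite ev0 eqxx.
Qed.

Lemma rmorph_mmap n (K A B : comNzRingType) (f : {rmorphism A -> B})
    (g : {rmorphism K -> A}) (h : 'I_n -> A) (P : mpoly n K) :
  f (mmap g h P) = mmap (f \o g) (f \o h) P.
Proof.
rewrite /mmap rmorph_sum; apply: eq_bigr => m _; rewrite rmorphM rmorph_prod.
by congr (_ * _); apply: eq_bigr => i _; rewrite rmorphXn.
Qed.

Lemma eq_mmap n (K A : comNzRingType) (g g' : K -> A) (h h' : 'I_n -> A) (P : mpoly n K) :
  g =1 g' -> h =1 h' -> mmap g h P = mmap g' h' P.
Proof.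
move=> eg eh; apply: eq_bigr => m _; rewrite eg; congr (_ * _).
by apply: eq_bigr => i _; rewrite eh.
Qed.

(* Deform the curve e generically, so that c survives, then let the deformation
   parameter tend to zero. *)
Lemma line_poly_irreducible (K : numClosedFieldType) n (v : 'I_n -> K) (F : mpoly n K) d
    (e : 'I_n -> {poly K}) (F0 : {poly {poly K}}) :
  F \is ishomog1 d mdeg -> meval v F != 0 ->
  (forall t z, F0.[t%:P].[z] = meval (fun i => (e i).[t] + z * v i) F) ->
  (forall D Q, swapXY F0 = D * Q -> size D = 1%N \/ size Q = 1%N) ->
  forall c D Q, c != 0 -> c *: line_poly v F = D * Q -> size D = 1%N \/ size Q = 1%N.
Proof.
move=> hF Fv F0E irr c D Q c0 E.
have [sL lL] := line_poly_top v hF.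
have sizeL : size (line_poly v F) = d.+1.
  apply/eqP; rewrite eqn_leq sL /= ltnNge; apply: contra Fv => /(nth_default 0).
  by rewrite lL => /eqP; rewrite mpolyC_eq0.
have leadL : lead_coef (line_poly v F) = mpolyC n (meval v F) by rewrite lead_coefE sizeL.
have [x cx] := mpoly_nonzero_point c0.
(* The outer variable is the deformation parameter: at 0 it gives the curve e, and at 1 with t = 0
   the point x, where c does not vanish. *)
have [phi phiC phiX] : exists2 phi : {rmorphism mpoly n K -> {poly {poly K}}},
    forall a, phi (mpolyC n a) = a%:P%:P &
    forall i, phi (mpolyX K (mnm1 i)) = (e i)%:P + ((x i)%:R - (e i).[0])%:P%:P * 'X.
  by exists (mmap (polyC \o polyC) (fun i => (e i)%:P + ((x i)%:R - (e i).[0])%:P%:P * 'X))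
    => [a|i] /=; rewrite ?mmapC ?mmapX ?mmap1U.
have phic : phi c != 0.
  apply: contraNneq cx => phic; have : (phi c).[1].[0] = 0 by rewrite phic !horner0.
  have -> : (phi c).[1].[0] = (horner_eval 0 \o horner_eval 1 \o phi) c by [].
  move=> /eqP; congr (_ == 0).
  apply: (@mpoly_morph_eq _ _ _ (horner_eval 0 \o horner_eval 1 \o phi) (meval _)) => [a|i] /=.
    by rewrite phiC mevalC /horner_eval !hornerC.
  by rewrite phiX mevalXU /horner_eval !(hornerD, hornerM, hornerC, hornerX) mulr1 addrC subrK.
have /(congr1 (map_poly phi)) := E; rewrite map_polyZ rmorphM /= => E1.
have sizes : size (map_poly phi D) = size D /\ size (map_poly phi Q) = size Q.
  have := congr1 (phi \o lead_coef) E; rewrite /= lead_coefZ lead_coefM leadL !rmorphM /= => E2.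
  have : phi (lead_coef D) * phi (lead_coef Q) != 0.
    by rewrite -E2 mulf_neq0 // phiC !polyC_eq0.
  by rewrite mulf_eq0 negb_or => /andP[nD nQ]; split; apply: size_map_poly_id0.
have leadphi : lead_coef (map_poly phi (line_poly v F)) = (meval v F)%:P%:P.
  have phiF : phi (mpolyC n (meval v F)) = (meval v F)%:P%:P := phiC _.
  have nz : phi (mpolyC n (meval v F)) != 0 by rewrite phiF !polyC_eq0.
  by rewrite lead_coef_map_eq leadL; [exact: phiC | exact: nz].
have [|c1 [D1 [Q1 [c10 E2 sD sQ]]]] := strip_eval (r := 0) phic _ E1.
  by rewrite leadphi hornerC polyC_eq0.
move: sizes; rewrite -sD -sQ => -[<- <-]; move: E2.
suff -> : map_poly (horner_eval 0) (map_poly phi (line_poly v F)) = swapXY F0.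
  by move/(gauss_closed c10) => [D2 [Q2 [E3 <- <-]]]; exact: irr E3.
rewrite -map_poly_comp; apply/eqP; rewrite -subr_eq0; apply/eqP/poly2_eq0 => z t.
rewrite !(hornerD, hornerN) horner2_swapXY F0E; apply/eqP; rewrite subr_eq0; apply/eqP.
have -> y : y.[t] = horner_eval t y by [].
rewrite horner_line_poly rmorph_mmap; apply: eq_mmap => [a|i] /=.
  by rewrite phiC /horner_eval !hornerC.
rewrite phiC phiX /horner_eval.
by rewrite !(hornerD, hornerM, hornerC, hornerX) mulr0 addr0 mulrC.
Qed.

(** * The discriminant generates the ideal of the boundary *)

Lemma resultant_common_root (A : comNzRingType) (B : comNzRingType) (f : {rmorphism A -> B})
    (p q : {poly A}) x : (1 < size p)%N -> (1 < size q)%N ->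
  (map_poly f p).[x] = 0 -> (map_poly f q).[x] = 0 -> f (resultant p q) = 0.
Proof.
move=> sp sq px qx; have [[u w] _ /= E] := resultant_in_ideal sp sq.
have := congr1 (fun r => (map_poly f r).[x]) E.
by rewrite /= map_polyC hornerC rmorphD !rmorphM /= !hornerE px qx !mulr0 addr0.
Qed.

Section Discriminant.
Context (K : numFieldType).

Definition gdisc : mpoly 10 K := disc (generic_tensor K).

Lemma meval_gdisc (a : 'rV[K]_10) : meval (a 0) gdisc = disc (tensor a).
Proof.
rewrite /gdisc disc_morph; congr disc.
by do 3![apply/funext => ?]; exact: meval_tensor.
Qed.

Lemma gdisc_dhomog : gdisc \is ishomog1 10 mdeg.
Proof.
apply: disc_dhomog => i j k; rewrite /generic_tensor mul_mpolyC; apply: dhomogZ.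
by rewrite dhomogX /= mdeg1.
Qed.

Definition coord_row (c : nat -> K) : 'rV[K]_10 := \row_m c m.

Lemma tensor_row c i j k n : index (sort leq [:: i.+1; j.+1; k.+1]) triples = n ->
  (n < 10)%N -> tensor (coord_row c) i j k = 4^-1 * c n.
Proof. by move=> E n10; rewrite /tensor mxE inordK E. Qed.

(* For x = 1 + t and w = i (t - 1) the cubic form with coefficients a_ijk is
   4 (V^3 + t U^3) + 24 s y_2 y_3 y_4, where U, V = y_2 +- i y_3. *)
Definition slice_row (x w s : K) := coord_row (fun m => match m with
  0%N => 4 * x | 1%N => 4 * w | 3%N => - (4 * x) | 4%N => 4 * s | 6%N => - (4 * w) | _ => 0 end).

(** Positions 0 and 4 carry a_222 and a_234; the factors 4 undo the quarter in [tensor]. *)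
Definition line_row (x s : K) :=
  coord_row (fun m => match m with 0%N => 4 * x | 4%N => 4 * s | _ => 0 end).

Lemma disc_slice_row x w s : disc (tensor (slice_row x w s)) = laplace 5 (slice_trace x w s).
Proof.
pose A := tensor (slice_row x w s).
have e111 : A 1 1 1 = x by rewrite /A (@tensor_row _ _ _ _ 0) // mulKf ?pnatr_eq0.
have e112 : A 1 1 2 = w by rewrite /A (@tensor_row _ _ _ _ 1) // mulKf ?pnatr_eq0.
have e123 : A 1 2 3 = s by rewrite /A (@tensor_row _ _ _ _ 4) // mulKf ?pnatr_eq0.
rewrite (disc_slice (symmetric3_tensor _)) -/A ?e111 ?e112 ?e123 //.
- by rewrite /A; do !split; [rewrite (@tensor_row _ _ _ _ 2) | rewrite (@tensor_row _ _ _ _ 5) |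
    rewrite (@tensor_row _ _ _ _ 7) | rewrite (@tensor_row _ _ _ _ 8) |
    rewrite (@tensor_row _ _ _ _ 9)]; rewrite ?mulr0.
- by rewrite /A (@tensor_row _ _ _ _ 3) // mulrN mulKf ?pnatr_eq0.
by rewrite /A (@tensor_row _ _ _ _ 6) // mulrN mulKf ?pnatr_eq0.
Qed.

Lemma trace_entry_line_row x s j k : (j < 5)%N -> (k < 5)%N ->
  trace_entry (tensor (line_row x s)) j k = line_trace x s j k.
Proof.
pose A := tensor (line_row x s).
have e111 : A 1 1 1 = x by rewrite /A (@tensor_row _ _ _ _ 0) // mulKf ?pnatr_eq0.
have e123 : A 1 2 3 = s by rewrite /A (@tensor_row _ _ _ _ 4) // mulKf ?pnatr_eq0.
move=> j5 k5; rewrite (trace_entry_line (symmetric3_tensor _)) -/A ?e111 ?e123 //.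
- by rewrite /A; do !split; [rewrite (@tensor_row _ _ _ _ 2) | rewrite (@tensor_row _ _ _ _ 5) |
    rewrite (@tensor_row _ _ _ _ 7) | rewrite (@tensor_row _ _ _ _ 8) |
    rewrite (@tensor_row _ _ _ _ 9)]; rewrite ?mulr0.
- by rewrite /A (@tensor_row _ _ _ _ 1) // mulr0.
- by rewrite /A (@tensor_row _ _ _ _ 3) // mulr0.
by rewrite /A (@tensor_row _ _ _ _ 6) // mulr0.
Qed.

Lemma disc_line_row x s :
  disc (tensor (line_row x s)) = 2 ^+ 26 * s ^+ 4 * (s ^+ 2 - x ^+ 2) ^+ 3.
Proof.
rewrite -laplace_line -det_laplace; congr (\det _).
by apply/matrixP => j k; rewrite !mxE trace_entry_line_row.
Qed.

Lemma gdisc_direction : meval (line_row 0 1 0) gdisc != 0.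
Proof.
rewrite meval_gdisc disc_line_row expr0n subr0 !expr1n !mulr1.
by rewrite expf_neq0 // pnatr_eq0.
Qed.
End Discriminant.

Lemma gdisc_line_irreducible (K : numClosedFieldType) (c : mpoly 10 K) D Q : c != 0 ->
  c *: line_poly (line_row 0 1 0) (gdisc K) = D * Q -> size D = 1%N \/ size Q = 1%N.
Proof.
pose e (m : nat) : {poly K} := match m with
  0%N => 4%:P * (1 + 'X) | 1%N => (4 * 'i)%:P * ('X - 1) | 3%N => - (4%:P * (1 + 'X))
  | 6%N => - ((4 * 'i)%:P * ('X - 1)) | _ => 0 end.
apply: (@line_poly_irreducible _ _ _ _ 10 e (slice_disc K)).
- exact: gdisc_dhomog.
- exact: gdisc_direction.
- move=> t z; rewrite (horner_slice_disc _ _ (sqrCi _)) -disc_slice_row -meval_gdisc.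
  apply: meval_eq => m; rewrite !mxE.
  case: m => [[|[|[|[|[|[|[|m]]]]]]] mlt] /=;
  rewrite ?(hornerN, hornerD, hornerM, hornerC, hornerX); ring.
have two n m : (2 ^+ n * m.+1%:R : K) != 0.
  by rewrite mulf_neq0 ?expf_neq0 ?pnatr_eq0.
by move=> D' Q'; apply: slice_irreducible; rewrite ?oppr_eq0 two.
Qed.

Lemma gdisc_irreducible (R : realType) : irreducible_mpoly (gdisc R[i]).
Proof.
set F := gdisc _; set v := line_row (0 : R[i]) 1 0.
have Fv : meval v F != 0 := gdisc_direction _.
have F0 : F != 0 by apply: contraNneq Fv => ->; rewrite meval0.
have line_top : lead_coef (line_poly v F) = mpolyC 10 (meval v F).
  have [sL lL] := line_poly_top v (gdisc_dhomog R[i]).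
  rewrite lead_coefE (_ : size _ = 11%N) //; apply/eqP.
  rewrite eqn_leq sL /= ltnNge; apply: contra Fv => /(nth_default 0).
  by rewrite lL => /eqP; rewrite mpolyC_eq0.
(* If G(a + Z v) is constant in Z it equals G, so G divides the leading coefficient F(v), a nonzero
   constant. *)
have size1_unit G H : F = G * H -> size (line_poly v G) = 1%N -> G \is a GRing.unit.
  move=> FGH /(fun e => eq_leq e)/line_poly_size1 G1.
  have := line_top; rewrite FGH line_polyM lead_coefM {1}G1 lead_coefC -FGH => E.
  have : mpolyC 10 (meval v F) \is a GRing.unit by apply: rmorph_unit; rewrite unitfE.
  by rewrite -E unitrM => /andP[].
split=> //.
  apply/negP => /(rmorph_unit (meval (line_row (0 : R[i]) 0 0))) /=.
  by rewrite meval_gdisc disc_line_row expr0n /= mulr0 mul0r unitr0.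
move=> G H E; have := @gdisc_line_irreducible R[i] 1 (line_poly v G) (line_poly v H) (oner_neq0 _).
rewrite scale1r -line_polyM -E => /(_ erefl)[] s1; [left | right].
  exact: size1_unit E s1.
exact: size1_unit (etrans E (mulrC _ _)) s1.
Qed.

Lemma gdisc_degree (R : realType) : mmeasure mdeg (gdisc R[i]) = 11%N.
Proof.
have [F0 _ _] := gdisc_irreducible R; have hF := gdisc_dhomog R[i].
have := dhomog_uniq F0 hF (dhomog_msize hF).
have : mmeasure mdeg (gdisc R[i]) != 0%N by rewrite mmeasure_poly_eq0.
by case: mmeasure => // m _ /= ->.
Qed.

Lemma addl_continuous (K : numFieldType) (V : normedModType K) (w : V) : continuous (+%R w).
Proof.
by move=> a; apply: (@cvgD K V _ _ _ (cst w) id w a); [exact: cvg_cst | exact: cvg_id].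
Qed.

Section Boundary.
Context (R : realType).
Local Notation bd := (closure (SSP_patch (quadric R)) `\` (closure (SSP_patch (quadric R)))°).

Lemma meval_gdisc_real (a : 'rV[R]_10) :
  meval (complexify a 0) (gdisc R[i]) = (disc (tensor a))%:C%C.
Proof.
rewrite meval_gdisc [RHS](disc_morph (real_complex R)); congr disc.
do 3![apply/funext => ?]; rewrite /tensor mxE rmorphM fmorphV /=.
by rewrite rmorph_nat.
Qed.

Lemma complexify_line_row (x s : R) : complexify (line_row x s) = line_row x%:C%C s%:C%C.
Proof.
apply/rowP => m; rewrite !mxE.
by case: m => [[|[|[|[|[|m]]]]] mlt] /=; rewrite ?rmorphM ?rmorph_nat ?rmorph0.
Qed.

Lemma near_boundary : exists p : 'rV[R]_10, \forall a \near p,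
  exists u : R, bd (a + u *: line_row 0 1).
Proof.
(* At x = 1 the form is positive definite for s = 2, and the shift by t leads to s = 1/2, where the
   discriminant is negative; both conditions are open. *)
exists (line_row 1 2); pose t : R := - (3 / 2).
have inS : SSP_patch (quadric R) (line_row 1 2).
  by apply/SSP_patchP/posdef_line => j k j5 k5; apply: trace_entry_line_row.
have neg : \forall a \near line_row (1 : R) 2, disc (tensor (a + t *: line_row 0 1)) < 0.
  suff : \forall a \near line_row (1 : R) 2, meval ((t *: line_row 0 1 + a) 0) (gdisc R) < 0.
    by apply: filterS => a; rewrite meval_gdisc addrC.
  pose w : 'rV[R]_10 := t *: line_row 0 1; rewrite -/w.
  have wc := @addl_continuous R 'rV[R]_10 w (line_row 1 2).
  have mc := @meval_continuous R 10 (gdisc R) (w + line_row 1 2).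
  have := continuous_comp wc mc.
  rewrite /continuous_at /= => /cvgr_lt; apply; rewrite addrC.
  have -> : line_row 1 2 + t *: line_row 0 1 = line_row (1 : R) (2^-1).
    apply/rowP => m; rewrite !mxE /t.
    by case: m => [[|[|[|[|[|m]]]]] mlt] /=; field.
  rewrite meval_gdisc disc_line_row.
  have -> : 2 ^+ 26 * 2^-1 ^+ 4 * (2^-1 ^+ 2 - 1 ^+ 2) ^+ 3 = - (2 ^+ 16 * 27) :> R by field.
  by rewrite oppr_lt0 mulr_gt0 // exprn_gt0.
apply: filterS2 (SSP_patch_open inS) neg => a Sa dneg.
exact: boundary_crossing Sa dneg.
Qed.

Lemma boundary_ideal (G : mpoly 10 R[i]) :
  (forall a, bd a -> meval (complexify a 0) G = 0) -> exists H, G = H * gdisc R[i].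
Proof.
move=> Gbd; set F := gdisc _; set v := line_row (0 : R[i]) 1 0.
have [p nearp] := near_boundary.
have vE (a : 'rV[R]_10) u (P : mpoly 10 R[i]) :
    (map_poly (meval (complexify a 0)) (line_poly v P)).[u%:C%C] =
    meval (complexify (a + u *: line_row 0 1) 0) P.
  rewrite meval_line_poly; apply: meval_eq => i.
  by rewrite /v -(rmorph0 (real_complex R)) -(rmorph1 (real_complex R)) -complexify_line_row
    !mxE [RHS]rmorphD /= rmorphM.
(* The resultant argument needs positive degree in Z. If G is constant along v, it vanishes on the
   ball itself and is zero. *)
have [sG|sG] := leqP (size (line_poly v G)) 1.
  exists 0; rewrite mul0r; apply: mpoly_eq0_near.
  apply: filterS nearp => a [u bu]; rewrite -(Gbd _ bu) -vE line_poly_size1 //.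
  by rewrite map_polyC hornerC.
have [sL lL] := line_poly_top v (gdisc_dhomog R[i]).
have sizeF : size (line_poly v F) = 11%N.
  apply/eqP; rewrite eqn_leq sL /= ltnNge; apply: contra (gdisc_direction R[i]) => /(nth_default 0).
  by rewrite lL => /eqP; rewrite mpolyC_eq0.
have sF : (1 < size (line_poly v F))%N by rewrite sizeF.
have uF : lead_coef (line_poly v F) \is a GRing.unit.
  by rewrite lead_coefE sizeF lL; apply: rmorph_unit; rewrite unitfE gdisc_direction.
have res0 : resultant (line_poly v F) (line_poly v G) = 0.
  apply: (mpoly_eq0_near (p := p)); apply: filterS nearp => a [u bu].
  by apply: (resultant_common_root (x := u%:C%C) sF sG); rewrite vE ?Gbd // meval_gdisc_real boundary_disc.
have [H E] := irreducible_dvd sF uF (@gdisc_line_irreducible R[i]) res0.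
(* At Z = 0 divisibility along the lines becomes divisibility of G by F. *)
exists H.[0]; rewrite -[LHS](line_poly_horner0 v) E hornerM; congr (_ * _).
exact: line_poly_horner0.
Qed.
End Boundary.

Theorem proposition2p15 (R : realType) :
  irreducible_hypersurface 10 (alg_boundary_SSP (quadric R)).
Proof.
exists (gdisc R[i]); split; [exact: gdisc_irreducible | exact: gdisc_degree |].
apply/seteqP; split=> a /=.
  apply=> _ [b bb <-]; rewrite /zero_locus /= meval_gdisc_real boundary_disc //.
move=> a0 G Gbd; have [|H ->] := @boundary_ideal R G.
  by move=> b bb; apply: Gbd; exists b.
by rewrite /zero_locus /= rmorphM /= a0 mulr0.
Qed.
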